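(* Let $k$ be a field and let $Q$ and $Q'$ be finite quivers. If $Q$ and $Q'$ become the same after repeatedly removing vertices that are sources or sinks (together with the arrows attached to them), then there is an equivalence of categories $\mathsf{QGr}(kQ)\equiv\mathsf{QGr}(kQ')$.
   Context: Quivers are finite directed graphs, with loops and multiple arrows allowed. A vertex is a sink if no arrows begin at it and a source if no arrows end at it. The path algebra $kQ$ (with $pq$ denoting the path $q$ followed by the path $p$) is $\mathbb{N}$-graded by path length. $\mathsf{Gr}(kQ)$ is the category of $\mathbb{Z}$-graded left $kQ$-modules with degree-preserving homomorphisms, $\mathsf{Fdim}(kQ)$ its full localizing subcategory of modules that are the sum of their finite-dimensional submodules, and $\mathsf{QGr}(kQ)=\mathsf{Gr}(kQ)/\mathsf{Fdim}(kQ)$. *)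

(* Defs.v *)
From HB Require Import structures.
From mathcomp Require Import all_boot all_order all_algebra.
From mathcomp Require Import finmap generic_quotient ring_quotient.
From mathcomp Require Import boolp monalg.

Set Implicit Arguments.
Unset Strict Implicit.
Unset Printing Implicit Defensive.

Import GRing.Theory.
Local Open Scope ring_scope.
Local Open Scope quotient_scope.

Record quiver := Quiver {
  vert : finType;
  arr : finType;
  asrc : arr -> vert;
  atgt : arr -> vert }.

Definition is_sink (Q : quiver) (v : vert Q) := forall a : arr Q, asrc a != v.
Definition is_source (Q : quiver) (v : vert Q) := forall a : arr Q, atgt a != v.

Definition keeps (Q : quiver) (v : vert Q) (a : arr Q) :=
  (asrc a != v) && (atgt a != v).

Definition remove_vertex (Q : quiver) (v : vert Q) : quiver :=
  {| vert := {w : vert Q | w != v};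
     arr := {a : arr Q | keeps v a};
     asrc := fun a => exist _ (asrc (sval a)) (proj1 (andP (svalP a)));
     atgt := fun a => exist _ (atgt (sval a)) (proj2 (andP (svalP a))) |}.

Inductive prunes_to : quiver -> quiver -> Prop :=
| prune_done Q : prunes_to Q Q
| prune_step Q (v : vert Q) R :
    is_source v \/ is_sink v -> prunes_to (remove_vertex v) R -> prunes_to Q R.

Definition quiver_iso (Q R : quiver) : Prop :=
  exists (f : vert Q -> vert R) (g : arr Q -> arr R),
    [/\ bijective f, bijective g,
        forall a, asrc (g a) = f (asrc a) & forall a, atgt (g a) = f (atgt a)].

Definition same_after_pruning (Q Q' : quiver) : Prop :=
  exists R R', [/\ prunes_to Q R, prunes_to Q' R' & quiver_iso R R'].

Section Paths.
Variable Q : quiver.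

(* A path is its starting vertex together with the arrows in the order in which
   they are followed; (v, [::]) is the trivial path at v. *)
Fixpoint is_path (v : vert Q) (s : seq (arr Q)) : bool :=
  if s is a :: s' then (asrc a == v) && is_path (atgt a) s' else true.

Record qpath := QPath {
  pval :> vert Q * seq (arr Q);
  pvalP : is_path pval.1 pval.2 }.

HB.instance Definition _ := [isSub for pval].
HB.instance Definition _ := [Choice of qpath by <:].

Definition psrc (p : qpath) : vert Q := (pval p).1.
Definition parrs (p : qpath) : seq (arr Q) := (pval p).2.
Definition ptgt (p : qpath) : vert Q := last (psrc p) (map (@atgt Q) (parrs p)).
Definition plen (p : qpath) : nat := size (parrs p).

Definition ptriv (v : vert Q) : qpath := @QPath (v, [::]) isT.

(* [pcomp p q] is the path q followed by the path p, when these compose. *)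
Definition pcomp (p q : qpath) : option qpath :=
  if psrc p == ptgt q then insub (psrc q, parrs q ++ parrs p) else None.

Lemma is_path_cat v s t :
  is_path v (s ++ t) = is_path v s && is_path (last v (map (@atgt Q) s)) t.
Proof. by elim: s v => //= a s IHs v; rewrite IHs andbA. Qed.

Lemma pcomp_arrs p q : psrc p = ptgt q ->
  exists2 r, pcomp p q = Some r & pval r = (psrc q, parrs q ++ parrs p).
Proof.
move=> e; rewrite /pcomp e eqxx.
have h : is_path (psrc q) (parrs q ++ parrs p).
  rewrite is_path_cat; apply/andP; split; first exact: (pvalP q).
  by rewrite -/(ptgt q) -e; exact: (pvalP p).
by exists (@QPath (psrc q, parrs q ++ parrs p) h); rewrite ?insubT.
Qed.

Lemma pcomp_none p q : psrc p != ptgt q -> pcomp p q = None.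
Proof. by rewrite /pcomp => /negbTE ->. Qed.

Lemma pcompA p q r :
  obind (pcomp p) (pcomp q r) = obind (fun x => pcomp x r) (pcomp p q).
Proof.
have [eqr|nqr] := eqVneq (psrc q) (ptgt r); last first.
  rewrite (pcomp_none nqr) /=.
  have [epq|npq] := eqVneq (psrc p) (ptgt q); last by rewrite pcomp_none.
  have [x -> ex] /= := pcomp_arrs epq.
  by rewrite pcomp_none // /psrc ex.
have [y -> ey] /= := pcomp_arrs eqr.
have ty : ptgt y = ptgt q.
  by rewrite /ptgt /psrc /parrs ey /= map_cat last_cat -/(ptgt r) -eqr.
have [epq|npq] := eqVneq (psrc p) (ptgt q); last first.
  by rewrite (pcomp_none npq) pcomp_none // ty.
have [x -> ex] /= := pcomp_arrs epq.
have [u -> eu] := pcomp_arrs (etrans epq (esym ty)).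
have exr : psrc x = ptgt r by rewrite /psrc ex.
have [w -> ew] := pcomp_arrs exr.
congr Some; apply: val_inj; rewrite /= eu ew /psrc /parrs ey ex /=.
by rewrite catA.
Qed.

Lemma pcomp_trivl v q : pcomp (ptriv v) q = if v == ptgt q then Some q else None.
Proof.
case: eqP => [e|/eqP ne]; last by rewrite pcomp_none.
have [r -> er] := @pcomp_arrs (ptriv v) q e; congr Some; apply: val_inj.
by rewrite /= er cats0 /psrc /parrs; case: (pval q).
Qed.

Lemma pcomp_trivr p v : pcomp p (ptriv v) = if psrc p == v then Some p else None.
Proof.
case: eqP => [e|/eqP ne]; last by rewrite pcomp_none.
have [r -> er] := @pcomp_arrs p (ptriv v) e; congr Some; apply: val_inj.
by rewrite /= er /= /psrc /parrs /= -e /psrc; case: (pval p).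
Qed.

End Paths.

(* Assembling an associative bilinear product from a partial multiplication of
   basis elements. *)
Section BilinearExtension.
Variables (k : fieldType) (A : lmodType k) (P : Type) (b : P -> A).
Variables (c : P -> P -> option P) (m : A -> A -> A).
Hypothesis A_ind : forall T : A -> Prop,
  T 0 -> (forall a p f, T f -> T (a *: b p + f)) -> forall f, T f.
Hypothesis mDl : left_distributive m +%R.
Hypothesis mDr : right_distributive m +%R.
Hypothesis mZl : forall a f g, m (a *: f) g = a *: m f g.
Hypothesis mZr : forall a f g, m f (a *: g) = a *: m f g.
Hypothesis mbb : forall p q, m (b p) (b q) = if c p q is Some r then b r else 0.
Hypothesis cA : forall p q r,
  obind (c p) (c q r) = obind (fun x => c x r) (c p q).

Lemma bilin0l g : m 0 g = 0.
Proof. by have := mZl 0 0 g; rewrite !scale0r. Qed.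

Lemma bilin0r g : m g 0 = 0.
Proof. by have := mZr 0 g 0; rewrite !scale0r. Qed.

Lemma bilinA : associative m.
Proof.
have A3 p q r : m (b p) (m (b q) (b r)) = m (m (b p) (b q)) (b r).
  rewrite !mbb; have := cA p q r.
  case: (c q r) => [x|]; case: (c p q) => [y|] /=; rewrite ?(bilin0l, bilin0r) //.
  - by rewrite !mbb => ->.
  - by rewrite mbb => ->.
  - by rewrite mbb => <-.
have A2 p q h : m (b p) (m (b q) h) = m (m (b p) (b q)) h.
  elim/A_ind: h => [|a r h IHh]; first by rewrite !bilin0r.
  by rewrite !mDr !mZr IHh A3.
have A1 p g h : m (b p) (m g h) = m (m (b p) g) h.
  elim/A_ind: g => [|a q g IHg]; first by rewrite !(bilin0r, bilin0l).
  by rewrite !(mDl, mDr) !(mZl, mZr) IHg A2.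
move=> f g h; elim/A_ind: f => [|a p f IHf]; first by rewrite !bilin0l.
by rewrite !mDl !mZl IHf A1.
Qed.

Lemma bilin_suml (I : finType) (F : I -> A) g :
  m (\sum_i F i) g = \sum_i m (F i) g.
Proof. exact: (big_morph (m^~ g) (fun x y => mDl x y g) (bilin0l g)). Qed.

Lemma bilin_sumr (I : finType) (F : I -> A) g :
  m g (\sum_i F i) = \sum_i m g (F i).
Proof. exact: (big_morph (m g) (mDr g) (bilin0r g)). Qed.

Section Unit.
Variables (V : finType) (e : V -> P) (s t : P -> V).
Hypothesis cel : forall v p, c (e v) p = if v == t p then Some p else None.
Hypothesis cer : forall p v, c p (e v) = if s p == v then Some p else None.

Lemma bilin1l : left_id (\sum_v b (e v)) m.
Proof.
elim/A_ind => [|a p f IHf]; first exact: bilin0r.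
rewrite mDr mZr IHf bilin_suml (bigD1 (t p)) //= mbb cel eqxx.
by rewrite big1 ?addr0 // => v /negbTE nv; rewrite mbb cel nv.
Qed.

Lemma bilin1r : right_id (\sum_v b (e v)) m.
Proof.
elim/A_ind => [|a p f IHf]; first exact: bilin0l.
rewrite mDl mZl IHf bilin_sumr (bigD1 (s p)) //= mbb cer eqxx.
by rewrite big1 ?addr0 // => v nv; rewrite mbb cer eq_sym (negbTE nv).
Qed.
End Unit.
End BilinearExtension.

(* Finitely supported functions from paths to k. *)
Definition path_alg (k : fieldType) (Q : quiver) : Type := {malg k[qpath Q]}.
HB.instance Definition _ k Q := GRing.Lmodule.on (path_alg k Q).

(* Locked, like pa_mul below, because unification of the unlocked terms does not
   terminate in reasonable time. *)
HB.lock Definition pbasis (k : fieldType) (Q : quiver) (p : qpath Q) :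
  path_alg k Q := << 1 *g p >>.

Definition pprod (k : fieldType) (Q : quiver) (p q : qpath Q) : path_alg k Q :=
  if pcomp p q is Some r then pbasis k r else 0.

Definition pa_one (k : fieldType) (Q : quiver) : path_alg k Q :=
  \sum_(v : vert Q) pbasis k (ptriv v).

HB.lock Definition pa_mul (k : fieldType) (Q : quiver) (f g : path_alg k Q) :
    path_alg k Q :=
  \sum_(p <- msupp f) \sum_(q <- msupp g) (f@_p * g@_q) *: pprod k p q.

Section PathAlgebra.
Variables (k : fieldType) (Q : quiver).
Local Notation path_alg := (path_alg k Q).
Local Notation pbasis := (@pbasis k Q).
Local Notation pprod := (@pprod k Q).
Local Notation pa_one := (pa_one k Q).
Local Notation pa_mul := (@pa_mul k Q).

Let monoE (f : path_alg) : f = \sum_(p <- msupp f) f@_p *: pbasis p.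
Proof.
rewrite {1}[f]monalgE; apply: eq_bigr => p _; apply/malgP => q.
by rewrite mcoeffZ pbasis.unlock !mcoeffU mulrnAr mulr1.
Qed.

Let mulw (d1 d2 : {fset qpath Q}) (f g : path_alg) :
  (msupp f `<=` d1)%fset -> (msupp g `<=` d2)%fset ->
  pa_mul f g = \sum_(p <- d1) \sum_(q <- d2) (f@_p * g@_q) *: pprod p q.
Proof.
move=> h1 h2; rewrite pa_mul.unlock (big_fset_incl _ h1) /=; last first.
  move=> p _ /mcoeff_outdom fp.
  by rewrite big1 // => q _; rewrite fp mul0r scale0r.
apply: eq_bigr => p _; apply: big_fset_incl => // q _ /mcoeff_outdom ->.
by rewrite mulr0 scale0r.
Qed.

Let mulDl : left_distributive pa_mul +%R.
Proof.
move=> f g h; pose d := (msupp f `|` msupp g)%fset.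
rewrite (@mulw d (msupp h)) ?msuppD_le ?fsubset_refl //.
rewrite (@mulw d (msupp h) f) ?fsubsetUl ?fsubset_refl //.
rewrite (@mulw d (msupp h) g) ?fsubsetUr ?fsubset_refl //.
rewrite -big_split /=; apply: eq_bigr => p _; rewrite -big_split /=.
by apply: eq_bigr => q _; rewrite mcoeffD mulrDl scalerDl.
Qed.

Let mulDr : right_distributive pa_mul +%R.
Proof.
move=> h f g; pose d := (msupp f `|` msupp g)%fset.
rewrite (@mulw (msupp h) d) ?msuppD_le ?fsubset_refl //.
rewrite (@mulw (msupp h) d h f) ?fsubsetUl ?fsubset_refl //.
rewrite (@mulw (msupp h) d h g) ?fsubsetUr ?fsubset_refl //.
rewrite -big_split /=; apply: eq_bigr => p _; rewrite -big_split /=.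
by apply: eq_bigr => q _; rewrite mcoeffD mulrDr scalerDl.
Qed.

Let mulZl c f g : pa_mul (c *: f) g = c *: pa_mul f g.
Proof.
rewrite (@mulw (msupp f) (msupp g)) ?msuppZ_le ?fsubset_refl //.
rewrite pa_mul.unlock scaler_sumr; apply: eq_bigr => p _; rewrite scaler_sumr.
by apply: eq_bigr => q _; rewrite mcoeffZ scalerA mulrA.
Qed.

Let mulZr c f g : pa_mul f (c *: g) = c *: pa_mul f g.
Proof.
rewrite (@mulw (msupp f) (msupp g)) ?msuppZ_le ?fsubset_refl //.
rewrite pa_mul.unlock scaler_sumr; apply: eq_bigr => p _; rewrite scaler_sumr.
by apply: eq_bigr => q _; rewrite mcoeffZ scalerA mulrCA.
Qed.

Let mulUU p q : pa_mul (pbasis p) (pbasis q) = pprod p q.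
Proof.
rewrite pbasis.unlock (mulw (@msuppU_le _ _ p 1) (@msuppU_le _ _ q 1)).
by rewrite !big_seq_fset1 !mcoeffUU mul1r scale1r.
Qed.

Let pa_ind (P : path_alg -> Prop) :
  P 0 -> (forall c p f, P f -> P (c *: pbasis p + f)) -> forall f, P f.
Proof.
move=> P0 PD f; rewrite (monoE f); elim: (enum_fset _) => [|p s IHs].
  by rewrite big_nil.
by rewrite big_cons; apply: PD.
Qed.

Let mulA : associative pa_mul.
Proof. exact: (bilinA pa_ind mulDl mulDr mulZl mulZr mulUU (@pcompA Q)). Qed.

Let mul1l : left_id pa_one pa_mul.
Proof.
exact: (bilin1l pa_ind mulDl mulDr mulZl mulZr mulUU (@pcomp_trivl Q)).
Qed.

Let mul1r_ : right_id pa_one pa_mul.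
Proof.
exact: (bilin1r pa_ind mulDl mulDr mulZl mulZr mulUU (@pcomp_trivr Q)).
Qed.

(* A possibly trivial ring: the quiver may have no vertices. *)
HB.instance Definition _ := GRing.Zmodule_isPzRing.Build path_alg
  mulA mul1l mul1r_ mulDl mulDr.

Lemma path_algM_basis p q : pbasis p * pbasis q = pprod p q.
Proof. exact: mulUU. Qed.

Lemma path_alg_scalerAl (c : k) (f g : path_alg) : c *: (f * g) = (c *: f) * g.
Proof. exact/esym/mulZl. Qed.

Lemma path_alg_scalerAr (c : k) (f g : path_alg) : c *: (f * g) = f * (c *: g).
Proof. exact/esym/mulZr. Qed.

Lemma path_algE (f : path_alg) : f = \sum_(p <- msupp f) f@_p *: pbasis p.
Proof. exact: monoE. Qed.

Lemma path_alg_ind (P : path_alg -> Prop) :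
  P 0 -> (forall c p f, P f -> P (c *: pbasis p + f)) -> forall f, P f.
Proof. exact: pa_ind. Qed.

Definition pa_homog (n : nat) (f : path_alg) : Prop :=
  forall p, p \in msupp f -> plen p = n.

End PathAlgebra.

(* Hom-sets are setoids: [heq] is the equality of morphisms. *)
Record category := Category {
  obj :> Type;
  hom : obj -> obj -> Type;
  heq : forall X Y, hom X Y -> hom X Y -> Prop;
  idm : forall X, hom X X;
  comp : forall X Y Z, hom Y Z -> hom X Y -> hom X Z;
  heq_refl : forall X Y (f : hom X Y), heq f f;
  heq_sym : forall X Y (f g : hom X Y), heq f g -> heq g f;
  heq_trans : forall X Y (f g h : hom X Y), heq f g -> heq g h -> heq f h;
  comp_heq : forall X Y Z (f f' : hom Y Z) (g g' : hom X Y),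
    heq f f' -> heq g g' -> heq (comp f g) (comp f' g');
  comp_idl : forall X Y (f : hom X Y), heq (comp (idm Y) f) f;
  comp_idr : forall X Y (f : hom X Y), heq (comp f (idm X)) f;
  compA : forall X Y Z W (f : hom Z W) (g : hom Y Z) (h : hom X Y),
    heq (comp f (comp g h)) (comp (comp f g) h) }.

Arguments hom {c} X Y : rename.
Arguments heq {c X Y} f g : rename.
Arguments idm {c} X : rename.
Arguments comp {c X Y Z} f g : rename.

Record functor (C D : category) := Functor {
  fobj :> C -> D;
  fmap : forall X Y : C, hom X Y -> hom (fobj X) (fobj Y);
  fmap_heq : forall (X Y : C) (f g : hom X Y), heq f g -> heq (fmap f) (fmap g);
  fmap_id : forall X : C, heq (fmap (idm X)) (idm (fobj X));
  fmap_comp : forall (X Y Z : C) (f : hom Y Z) (g : hom X Y),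
    heq (fmap (comp f g)) (comp (fmap f) (fmap g)) }.

Arguments fmap {C D} f {X Y} _ : rename.

Definition functor_id (C : category) : functor C C.
Proof.
exists (fun X => X) (fun X Y f => f) => //.
- by move=> X; apply: heq_refl.
- by move=> X Y Z f g; apply: heq_refl.
Defined.

Definition functor_comp (C D E : category) (G : functor D E) (F : functor C D) :
  functor C E.
Proof.
exists (fun X => G (F X)) (fun X Y f => fmap G (fmap F f)).
- by move=> X Y f g e; do 2!apply: fmap_heq.
- move=> X; apply: heq_trans (fmap_id G _); apply: fmap_heq; exact: fmap_id.
- move=> X Y Z f g; apply: heq_trans (fmap_comp G _ _).
  by apply: fmap_heq; exact: fmap_comp.
Defined.

Record nat_iso (C D : category) (F G : functor C D) := NatIso {
  nt : forall X : C, hom (F X) (G X);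
  nt_inv : forall X : C, hom (G X) (F X);
  nt_natural : forall (X Y : C) (f : hom X Y),
    heq (comp (nt Y) (fmap F f)) (comp (fmap G f) (nt X));
  nt_invl : forall X, heq (comp (nt_inv X) (nt X)) (idm (F X));
  nt_invr : forall X, heq (comp (nt X) (nt_inv X)) (idm (G X)) }.

Definition equivalent_categories (C D : category) : Prop :=
  exists (F : functor C D) (G : functor D C),
    inhabited (nat_iso (functor_comp G F) (functor_id C)) /\
    inhabited (nat_iso (functor_comp F G) (functor_id D)).

(* C[W^-1], by generators and relations: its morphisms are formal composites of
   morphisms of C and formal inverses of the elements of W, modulo the smallest
   congruence making C -> C[W^-1] a functor that inverts the elements of W. *)
Section Localization.
Variable C : category.
Variable W : forall X Y : C, hom X Y -> Prop.

Inductive fraction : C -> C -> Type :=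
| frac_hom X Y : @hom C X Y -> fraction X Y
| frac_inv X Y (s : @hom C X Y) : W s -> fraction Y X
| frac_comp X Y Z : fraction Y Z -> fraction X Y -> fraction X Z.

Inductive frac_eq : forall X Y : C, fraction X Y -> fraction X Y -> Prop :=
| fe_refl X Y (f : fraction X Y) : frac_eq f f
| fe_sym X Y (f g : fraction X Y) : frac_eq f g -> frac_eq g f
| fe_trans X Y (f g h : fraction X Y) :
    frac_eq f g -> frac_eq g h -> frac_eq f h
| fe_comp X Y Z (f f' : fraction Y Z) (g g' : fraction X Y) :
    frac_eq f f' -> frac_eq g g' ->
    frac_eq (frac_comp f g) (frac_comp f' g')
| fe_idl X Y (f : fraction X Y) : frac_eq (frac_comp (frac_hom (idm Y)) f) f
| fe_idr X Y (f : fraction X Y) : frac_eq (frac_comp f (frac_hom (idm X))) f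
| fe_assoc X Y Z T (f : fraction Z T) (g : fraction Y Z) (h : fraction X Y) :
    frac_eq (frac_comp f (frac_comp g h)) (frac_comp (frac_comp f g) h)
| fe_hom_heq X Y (f g : @hom C X Y) :
    heq f g -> frac_eq (frac_hom f) (frac_hom g)
| fe_hom_comp X Y Z (f : @hom C Y Z) (g : @hom C X Y) :
    frac_eq (frac_hom (comp f g)) (frac_comp (frac_hom f) (frac_hom g))
| fe_invl X Y (s : @hom C X Y) (Ws : W s) :
    frac_eq (frac_comp (frac_inv Ws) (frac_hom s)) (frac_hom (idm X))
| fe_invr X Y (s : @hom C X Y) (Ws : W s) :
    frac_eq (frac_comp (frac_hom s) (frac_inv Ws)) (frac_hom (idm Y)).

Definition localization : category :=
  {| obj := C; hom := fraction; heq := frac_eq;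
     idm := fun X => frac_hom (idm X); comp := frac_comp;
     heq_refl := fe_refl; heq_sym := fe_sym; heq_trans := fe_trans;
     comp_heq := fe_comp; comp_idl := fe_idl; comp_idr := fe_idr;
     compA := fe_assoc |}.

End Localization.

Section SubQuotient.
Variables (R : pzRingType) (M : lmodType R) (S : submodClosed M).

Definition submodule : Type := {x : M | x \in S}.
HB.instance Definition _ := [isSub of submodule for @sval M (fun x => x \in S)].
HB.instance Definition _ := [Choice of submodule by <:].
HB.instance Definition _ := [SubChoice_isSubLmodule of submodule by <:].

(* S as an additive subgroup: submodClosed does not record closure under opp. *)
Definition zmod_of : {pred M} := fun x => x \in S.
Let zmod_of_closed : zmod_closed zmod_of.
Proof.
split=> [|x y xS yS]; first exact: (rpred0 S).
by rewrite -[x - y]/(x + - y) -scaleN1r; apply: (rpredD xS); apply: rpredZ.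
Qed.
HB.instance Definition _ := GRing.isZmodClosed.Build M zmod_of zmod_of_closed.

Definition quotmodule : Type := Quotient.quot zmod_of.
HB.instance Definition _ := GRing.Zmodule.on quotmodule.

Definition quotproj (x : M) : quotmodule := \pi_(Quotient.quot zmod_of) x.

Lemma quotproj_eq x y : (quotproj x = quotproj y) <-> (x - y \in S).
Proof.
by rewrite (Quotient.idealrBE zmod_of x y); split=> [e|/eqP //]; apply/eqP.
Qed.

Lemma quotproj_surj (z : quotmodule) : exists x, quotproj x = z.
Proof. by exists (repr z); exact: reprK. Qed.

Let quotprojD x y : quotproj (x + y) = quotproj x + quotproj y.
Proof. by rewrite /quotproj !piE. Qed.

Let scale (a : R) (z : quotmodule) : quotmodule := quotproj (a *: repr z).

Let scaleE a x : scale a (quotproj x) = quotproj (a *: x).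
Proof.
apply/quotproj_eq; rewrite -scalerBr; apply: rpredZ.
by apply/quotproj_eq; exact: reprK.
Qed.

Let scaleA a b z : scale a (scale b z) = scale (a * b) z.
Proof. by have [x <-] := quotproj_surj z; rewrite !scaleE scalerA. Qed.

Let scale1 : left_id 1 scale.
Proof. by move=> z; have [x <-] := quotproj_surj z; rewrite scaleE scale1r. Qed.

Let scaleDr : right_distributive scale +%R.
Proof.
move=> a z t; have [x <-] := quotproj_surj z; have [y <-] := quotproj_surj t.
by rewrite !scaleE -!quotprojD -scalerDr scaleE.
Qed.

Let scaleDl z : {morph scale^~ z : a b / a + b}.
Proof.
move=> a b; have [x <-] := quotproj_surj z.
by rewrite !scaleE -quotprojD scalerDl.
Qed.

HB.instance Definition _ := GRing.Zmodule_isLmodule.Build R quotmodule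
  scaleA scale1 scaleDr scaleDl.

Let quotproj_linear : linear quotproj.
Proof. by move=> a x y; rewrite quotprojD -scaleE. Qed.

HB.instance Definition _ :=
  GRing.isLinear.Build R M quotmodule _ quotproj quotproj_linear.
End SubQuotient.

Section Graded.
Variables (k : fieldType) (Q : quiver).
Local Notation A := (path_alg k Q).

(* A left A-module M together with a decomposition M = (+)_i M_i into subgroups
   M_i = [gdeg i], such that A_n M_i is contained in M_(n + i). *)
Record grmod := GrMod {
  gcar :> lmodType A;
  gdeg : int -> zmodClosed gcar;
  gdeg_span : forall x : gcar, exists (s : seq int) (c : int -> gcar),
    (forall i, c i \in gdeg i) /\ x = \sum_(i <- s) c i;
  gdeg_free : forall (s : seq int) (c : int -> gcar), uniq s ->
    (forall i, c i \in gdeg i) -> \sum_(i <- s) c i = 0 ->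
    forall i, i \in s -> c i = 0;
  gdeg_act : forall (n : nat) (i : int) (a : A) (x : gcar),
    pa_homog n a -> x \in gdeg i -> a *: x \in gdeg (n%:Z + i) }.

Record grhom (M N : grmod) := GrHom {
  gfun :> {linear M -> N};
  gfun_deg : forall i (x : M), x \in gdeg M i -> gfun x \in gdeg N i }.

Lemma grid_deg (M : grmod) i (x : M) :
  x \in gdeg M i -> (idfun : {linear M -> M}) x \in gdeg M i.
Proof. by []. Qed.
Definition grid (M : grmod) : grhom M M := GrHom (@grid_deg M).

Lemma grcomp_deg (M N P : grmod) (f : grhom N P) (g : grhom M N) i (x : M) :
  x \in gdeg M i -> (gfun f \o gfun g : {linear M -> P}) x \in gdeg P i.
Proof. by move=> xi; do 2!apply: gfun_deg. Qed.
Definition grcomp (M N P : grmod) (f : grhom N P) (g : grhom M N) : grhom M P :=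
  GrHom (@grcomp_deg M N P f g).

Definition Gr : category.
Proof.
exists grmod grhom (fun M N f g => forall x : M, f x = g x) grid grcomp => //.
- by move=> M N f g h fg gh x; rewrite fg gh.
- by move=> M N P f f' g g' ff' gg' x /=; rewrite gg' ff'.
Defined.

(* A graded submodule: it is the sum of its intersections with the M_i. *)
Record grsub (M : grmod) := GrSub {
  gscar :> submodClosed M;
  gs_homog : forall x : M, x \in gscar -> exists (s : seq int) (c : int -> M),
    [/\ forall i, c i \in gdeg M i, forall i, c i \in gscar &
        x = \sum_(i <- s) c i] }.

Section SubMod.
Variables (M : grmod) (S : grsub M).

Definition sub_deg (i : int) : {pred submodule S} := fun x => val x \in gdeg M i.

Let sub_deg_closed i : zmod_closed (sub_deg i).
Proof.
split=> [|x y xi yi]; first by rewrite unfold_in; exact: (rpred0 (gdeg M i)).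
by rewrite unfold_in raddfB; exact: (rpredB xi yi).
Qed.
HB.instance Definition _ i :=
  GRing.isZmodClosed.Build (submodule S) (sub_deg i) (sub_deg_closed i).

Let sub_deg_span (x : submodule S) : exists (s : seq int) (c : int -> submodule S),
  (forall i, c i \in (sub_deg i : zmodClosed _)) /\ x = \sum_(i <- s) c i.
Proof.
have [s [c [ci cS xE]]] := gs_homog (valP x).
exists s, (fun i => Sub (c i) (cS i)); split=> [i|].
  by rewrite unfold_in /sub_deg SubK; exact: ci.
apply: val_inj; rewrite raddf_sum {1}xE; exact: eq_bigr.
Qed.

Let sub_deg_free (s : seq int) (c : int -> submodule S) : uniq s ->
  (forall i, c i \in (sub_deg i : zmodClosed _)) -> \sum_(i <- s) c i = 0 ->
  forall i, i \in s -> c i = 0.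
Proof.
move=> us ci c0 i si; apply: val_inj; rewrite raddf0.
apply: (@gdeg_free M s (fun i => val (c i))) => //.
by rewrite -raddf_sum c0 raddf0.
Qed.

Let sub_deg_act (n : nat) (i : int) (a : A) (x : submodule S) : pa_homog n a ->
  x \in (sub_deg i : zmodClosed _) ->
  a *: x \in (sub_deg (n%:Z + i) : zmodClosed _).
Proof.
by move=> an xi; rewrite unfold_in /sub_deg linearZ; exact: gdeg_act.
Qed.

Definition subGr : grmod := GrMod sub_deg_span sub_deg_free sub_deg_act.
End SubMod.

Section QuotMod.
Variables (M : grmod) (S : grsub M).

Definition quot_deg (i : int) : {pred quotmodule S} :=
  fun z => `[< exists2 x, x \in gdeg M i & quotproj S x = z >].

Let quot_deg_closed i : zmod_closed (quot_deg i).
Proof.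
split=> [|z t /asboolP[x xi <-] /asboolP[y yi <-]]; apply/asboolP.
  by exists 0; [exact: (rpred0 (gdeg M i)) | exact: raddf0].
by exists (x - y); [exact: (rpredB xi yi) | exact: raddfB].
Qed.
HB.instance Definition _ i :=
  GRing.isZmodClosed.Build (quotmodule S) (quot_deg i) (quot_deg_closed i).

Let quot_deg_span (z : quotmodule S) : exists (s : seq int) (c : int -> quotmodule S),
  (forall i, c i \in (quot_deg i : zmodClosed _)) /\ z = \sum_(i <- s) c i.
Proof.
have [x <-] := quotproj_surj z; have [s [c [ci ->]]] := gdeg_span x.
exists s, (fun i => quotproj S (c i)); split=> [i|]; last exact: raddf_sum.
by apply/asboolP; exists (c i).
Qed.

Let quot_deg_free (s : seq int) (c : int -> quotmodule S) : uniq s ->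
  (forall i, c i \in (quot_deg i : zmodClosed _)) -> \sum_(i <- s) c i = 0 ->
  forall i, i \in s -> c i = 0.
Proof.
move=> us ci; have /choice[x xP] : forall i, exists x,
    x \in gdeg M i /\ quotproj S x = c i.
  by move=> i; have /asboolP[x] := ci i; exists x.
have -> : c = quotproj S \o x by apply/funext => i /=; have [] := xP i.
rewrite -raddf_sum -(raddf0 (quotproj S)) => /quotproj_eq; rewrite subr0.
move=> /gs_homog[t [d [dM dS E]]] i si; apply/quotproj_eq; rewrite subr0.
pose r := undup (s ++ t).
pose y j := (if j \in s then x j else 0) - d j *+ count_mem j t.
have yM j : y j \in gdeg M j.
  apply: rpredB; last by apply: rpredMn; exact: dM.
  by case: ifP => _; [have [] := xP j | exact: (rpred0 (gdeg M j))].
have y0 : \sum_(j <- r) y j = 0.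
  rewrite sumrB -big_mkcond /=; apply/eqP; rewrite subr_eq0; apply/eqP.
  rewrite -[LHS]big_filter.
  have /(perm_big _) -> : perm_eq [seq j <- r | j \in s] s.
    apply: uniq_perm; rewrite ?filter_uniq ?undup_uniq // => j.
    by rewrite mem_filter mem_undup mem_cat; case: (j \in s).
  rewrite E; transitivity (\sum_(j <- undup t) d j *+ count_mem j t).
    by rewrite big_undup_iterop_count.
  rewrite [RHS](bigID (fun j => j \in t)) /= [X in _ + X]big1 ?addr0; last first.
    by move=> j /count_memPn ->; rewrite mulr0n.
  rewrite -[RHS]big_filter; apply: perm_big.
  apply: uniq_perm; rewrite ?filter_uniq ?undup_uniq // => j.
  by rewrite mem_filter !mem_undup mem_cat; case: (j \in t); rewrite ?orbT.
have := gdeg_free (undup_uniq _) yM y0 (_ : i \in r).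
rewrite mem_undup mem_cat si /y si => /(_ isT)/eqP; rewrite subr_eq0 => /eqP ->.
by apply: rpredMn; exact: dS.
Qed.

Let quot_deg_act (n : nat) (i : int) (a : A) (z : quotmodule S) : pa_homog n a ->
  z \in (quot_deg i : zmodClosed _) ->
  a *: z \in (quot_deg (n%:Z + i) : zmodClosed _).
Proof.
move=> an /asboolP[x xi <-]; apply/asboolP; exists (a *: x).
  exact: gdeg_act.
exact: linearZ.
Qed.

Definition quotGr : grmod := GrMod quot_deg_span quot_deg_free quot_deg_act.
End QuotMod.

Lemma gdeg_span_uniq (M : grmod) (x : M) : exists (s : seq int) (c : int -> M),
  [/\ uniq s, forall i, c i \in gdeg M i & x = \sum_(i <- s) c i].
Proof.
have [s [c [ci ->]]] := gdeg_span x.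
exists (undup s), (fun i => c i *+ count_mem i s); split.
- exact: undup_uniq.
- by move=> i; apply: rpredMn; exact: ci.
- by rewrite big_undup_iterop_count.
Qed.

Section KerIm.
Variables (M N : grmod) (f : grhom M N).

Definition ker_pred : {pred M} := fun x => f x == 0.

Let ker_closed : subsemimod_closed ker_pred.
Proof.
split; first split.
- by apply/eqP; rewrite raddf0.
- by move=> x y /eqP x0 /eqP y0; apply/eqP; rewrite raddfD /= x0 y0 addr0.
- by move=> a x /eqP x0; apply/eqP; rewrite linearZ /= x0 scaler0.
Qed.
HB.instance Definition _ :=
  GRing.isSubSemiModClosed.Build A M ker_pred ker_closed.

Let ker_homog (x : M) : x \in (ker_pred : submodClosed M) ->
  exists (s : seq int) (c : int -> M),
    [/\ forall i, c i \in gdeg M i,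
        forall i, c i \in (ker_pred : submodClosed M) & x = \sum_(i <- s) c i].
Proof.
have [s [c [us ci ->]]] := gdeg_span_uniq x => /eqP; rewrite raddf_sum /= => f0.
exists s, (fun i => if i \in s then c i else 0); split=> [i|i|].
- by case: ifP => _; [exact: ci | exact: (rpred0 (gdeg M i))].
- apply/eqP; case: ifP => [si|_]; last exact: raddf0.
  apply: (@gdeg_free N s (fun i => f (c i))) => // j.
  by apply: gfun_deg; exact: ci.
- by rewrite big_seq [RHS]big_seq; apply: eq_bigr => i ->.
Qed.

Definition grker : grsub M := GrSub ker_homog.

Definition im_pred : {pred N} := fun y => `[< exists x, f x = y >].

Let im_closed : subsemimod_closed im_pred.
Proof.
split; first split.
- by apply/asboolP; exists 0; rewrite raddf0.
- move=> _ _ /asboolP[x <-] /asboolP[y <-]; apply/asboolP.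
  by exists (x + y); rewrite raddfD.
- move=> a _ /asboolP[x <-]; apply/asboolP.
  by exists (a *: x); rewrite linearZ.
Qed.
HB.instance Definition _ :=
  GRing.isSubSemiModClosed.Build A N im_pred im_closed.

Let im_homog (y : N) : y \in (im_pred : submodClosed N) ->
  exists (s : seq int) (c : int -> N),
    [/\ forall i, c i \in gdeg N i,
        forall i, c i \in (im_pred : submodClosed N) & y = \sum_(i <- s) c i].
Proof.
move=> /asboolP[x <-]; have [s [c [ci ->]]] := gdeg_span x.
exists s, (fun i => f (c i)); split=> [i|i|]; last exact: raddf_sum.
- by apply: gfun_deg; exact: ci.
- by apply/asboolP; exists (c i).
Qed.

Definition grim : grsub N := GrSub im_homog.
End KerIm.

(* The ground field acts through the scalars c.1 of A. *)
Definition fin_dim (M : grmod) : Prop :=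
  exists (n : nat) (b : 'I_n -> M), forall x : M, exists c : 'I_n -> k,
    x = \sum_(i < n) (c i *: (1 : A)) *: b i.

(* Sum is the internal sum in Gr, so the submodules are graded. *)
Definition Fdim (M : grmod) : Prop :=
  forall x : M, exists (n : nat) (S : 'I_n -> grsub M) (y : 'I_n -> M),
    (forall i, fin_dim (subGr (S i)) /\ y i \in gscar (S i)) /\
    x = \sum_(i < n) y i.

Definition Fdim_iso (M N : Gr) (f : @hom Gr M N) : Prop :=
  Fdim (subGr (grker f)) /\ Fdim (quotGr (grim f)).

(* The quotient of the abelian category Gr by its Serre subcategory Fdim: the
   localization at the morphisms whose kernel and cokernel lie in Fdim. *)
Definition QGr : category := localization Fdim_iso.

End Graded.

(* Main.v *)
(* It suffices to treat one vertex v that is a source or a sink; let P be Q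
   without v. Extending paths of P to Q, and killing the paths of Q that meet v,
   are graded multiplicative maps phi : kP -> kQ and psi : kQ -> kP with
   psi \o phi = id, where phi is not unital: e = phi 1 is the sum of the trivial
   paths away from v. Pulling modules back along phi (M |-> e M) and along psi
   (extension by zero) gives functors between Gr(kQ) and Gr(kP) whose composite
   on Gr(kP) is the identity. On Gr(kQ), if v is a source, e M is a submodule of
   M, and if v is a sink, e M is a quotient of M; in both cases the difference
   is concentrated at v, so that every path of positive length kills it.
   Since Q is finite, a module is in Fdim exactly when each of its elements is
   killed by all long paths. This makes it evident that both functors respect
   the localization and that M and e M become isomorphic there. *)
From HB Require Import structures.
From mathcomp Require Import all_boot all_order all_algebra.
From mathcomp Require Import finmap boolp monalg zify.
Require Import Defs.

Set Implicit Arguments.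
Unset Strict Implicit.
Unset Printing Implicit Defensive.

Import GRing.Theory.
Local Open Scope ring_scope.

(** * Equivalences between localizations *)

Lemma equivalent_sym (C D : category) :
  equivalent_categories C D -> equivalent_categories D C.
Proof. by move=> [F [G [GF FG]]]; exists G, F. Qed.

Lemma comp_heql (C : category) (X Y Z : C) (f f' : hom Y Z) (g : hom X Y) :
  heq f f' -> heq (comp f g) (comp f' g).
Proof. by move=> e; apply: comp_heq => //; exact: heq_refl. Qed.

Lemma comp_heqr (C : category) (X Y Z : C) (f : hom Y Z) (g g' : hom X Y) :
  heq g g' -> heq (comp f g) (comp f g').
Proof. by move=> e; apply: comp_heq => //; exact: heq_refl. Qed.

Lemma comp_cancel (C : category) (X Y Z : C)
    (s : hom Y X) (s' : hom X Y) (f : hom Z Y) (g : hom Y Z) :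
  heq (comp f g) (idm Y) -> heq (comp s s') (idm X) ->
  heq (comp (comp s f) (comp g s')) (idm X).
Proof.
move=> fg ss'; apply: heq_trans ss'; apply: heq_trans (compA _ _ _) _.
apply: comp_heql; apply: heq_trans (heq_sym (compA _ _ _)) _.
by apply: heq_trans (comp_idr _); exact: comp_heqr.
Qed.

Lemma fmap_cancel (C D : category) (F : functor C D) (X Y : C)
    (f : hom X Y) (g : hom Y X) :
  heq (comp f g) (idm Y) -> heq (comp (fmap F f) (fmap F g)) (idm (F Y)).
Proof.
move=> e; apply: heq_trans (heq_sym (fmap_comp F _ _)) _.
by apply: heq_trans (fmap_id F _); exact: fmap_heq.
Qed.

Lemma nat_iso_trans_id (C D E : category) (F : functor C D) (F' : functor D E)
    (G' : functor E D) (G : functor D C) :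
  nat_iso (functor_comp G F) (functor_id C) ->
  nat_iso (functor_comp G' F') (functor_id D) ->
  nat_iso (functor_comp (functor_comp G G') (functor_comp F' F)) (functor_id C).
Proof.
move=> [n n' nn nl nr] [m m' mn ml mr].
exists (fun X => comp (n X) (fmap G (m (F X))) :
          hom (functor_comp (functor_comp G G') (functor_comp F' F) X) X)
  (fun X => comp (fmap G (m' (F X))) (n' X)) => [X Y f|X|X] /=.
- apply: heq_trans (heq_sym (compA _ _ _)) _.
  apply: heq_trans (heq_sym (compA _ _ _)).
  apply: heq_trans (comp_heqr _ (heq_sym (fmap_comp G _ _))) _.
  apply: heq_trans (comp_heqr _ (fmap_heq _ (mn _ _ (fmap F f)))) _.
  apply: heq_trans (comp_heqr _ (fmap_comp G _ _)) _.
  apply: heq_trans (compA _ _ _) _; exact: comp_heql (nn _ _ f).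
- by apply: comp_cancel; [exact: nl | exact: fmap_cancel (ml _)].
- by apply: comp_cancel; [exact: fmap_cancel (mr _) | exact: nr].
Qed.

Lemma equivalent_trans (C D E : category) :
  equivalent_categories C D -> equivalent_categories D E ->
  equivalent_categories C E.
Proof.
move=> [F [G [[GF] [FG]]]] [F' [G' [[GF'] [FG']]]].
exists (functor_comp F' F), (functor_comp G G'); split; constructor.
  exact: nat_iso_trans_id GF GF'.
exact: nat_iso_trans_id FG' FG.
Qed.

Section LocalizedFunctor.
Variables (C D : category).
Variables (V : forall X Y : C, hom X Y -> Prop).
Variables (W : forall X Y : D, hom X Y -> Prop).
Variables (F : functor C D).
Hypothesis FW : forall (X Y : C) (f : hom X Y), V f -> W (fmap F f).

(** The functor induced by the universal property of localization, by recursion on formal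
    composites; [FW] makes the image of an inverted morphism invertible. *)
Fixpoint loc_fmap (X Y : C) (f : fraction V X Y) : fraction W (F X) (F Y) :=
  match f in fraction _ X Y return fraction W (F X) (F Y) with
  | frac_hom X Y f => frac_hom W (fmap F f)
  | frac_inv X Y s Vs => frac_inv (FW Vs)
  | frac_comp X Y Z f g => frac_comp (loc_fmap f) (loc_fmap g)
  end.

Lemma loc_fmap_heq (X Y : C) (f g : fraction V X Y) :
  frac_eq f g -> frac_eq (loc_fmap f) (loc_fmap g).
Proof.
elim=> {X Y f g} /=.
- by move=> *; apply: fe_refl.
- by move=> *; apply: fe_sym.
- by move=> X Y f g h _ fg _ gh; apply: fe_trans fg gh.
- by move=> *; apply: fe_comp.
- move=> X Y f; apply: fe_trans (fe_idl _).
  by apply: fe_comp (fe_refl _); apply: fe_hom_heq; exact: fmap_id.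
- move=> X Y f; apply: fe_trans (fe_idr _).
  by apply: (fe_comp (fe_refl _)); apply: fe_hom_heq; exact: fmap_id.
- by move=> *; apply: fe_assoc.
- by move=> *; apply: fe_hom_heq; exact: fmap_heq.
- move=> X Y Z f g; apply: fe_trans (fe_hom_comp _ _ _).
  by apply: fe_hom_heq; exact: fmap_comp.
- move=> X Y s Vs; apply: fe_trans (fe_invl _) _.
  by apply/fe_sym/fe_hom_heq; exact: fmap_id.
- move=> X Y s Vs; apply: fe_trans (fe_invr _) _.
  by apply/fe_sym/fe_hom_heq; exact: fmap_id.
Qed.

Definition loc_functor : functor (localization V) (localization W).
Proof.
apply: (@Functor (localization V) (localization W) (fun X => F X) loc_fmap) => /=.
- exact: loc_fmap_heq.
- by move=> X; apply: fe_hom_heq; exact: fmap_id.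
- by move=> X Y Z f g; apply: fe_refl.
Defined.

End LocalizedFunctor.

(** This serves the formal inverses in a localization. Insert on the left the identity
    [comp (fmap G t) (fmap G u)], then use the square of [u] and cancel [fmap F u] against
    [fmap F t]. *)
Lemma natural_inverse (C D : category) (F G : functor C D)
    (n : forall X : C, hom (F X) (G X)) (X Y : C) (u : hom X Y) (t : hom Y X) :
  heq (comp (n Y) (fmap F u)) (comp (fmap G u) (n X)) ->
  heq (comp t u) (idm X) -> heq (comp u t) (idm Y) ->
  heq (comp (n X) (fmap F t)) (comp (fmap G t) (n Y)).
Proof.
move=> nu tu ut; apply: heq_trans (_ : heq
  (comp (comp (fmap G t) (fmap G u)) (comp (n X) (fmap F t))) _).
  exact: heq_trans (heq_sym (comp_idl _))
                   (comp_heql _ (heq_sym (fmap_cancel G tu))).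
apply: heq_trans (heq_sym (compA _ _ _)) _; apply: comp_heqr.
apply: heq_trans (compA _ _ _) _; apply: heq_trans (comp_heql _ (heq_sym nu)) _.
apply: heq_trans (heq_sym (compA _ _ _)) _.
by apply: heq_trans (comp_idr _); apply: comp_heqr; exact: fmap_cancel.
Qed.

(** Naturality needs checking only on morphisms of [C]: it passes to formal inverses by
    [natural_inverse] and to composites by pasting squares. *)
Lemma loc_nat_iso (C D : category) (V : forall X Y : C, hom X Y -> Prop)
    (F G : functor (localization V) D)
    (n : forall X : C, hom (F X) (G X)) (n' : forall X : C, hom (G X) (F X)) :
  (forall (X Y : C) (f : hom X Y), heq (comp (n Y) (fmap F (frac_hom V f)))
                                       (comp (fmap G (frac_hom V f)) (n X))) ->
  (forall X, heq (comp (n' X) (n X)) (idm (F X))) ->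
  (forall X, heq (comp (n X) (n' X)) (idm (G X))) ->
  nat_iso F G.
Proof.
move=> nn nl nr; exists n n' => // X Y; elim=> {X Y} [//|X Y s Vs|X Y Z f IHf g IHg].
- apply: (natural_inverse (u := frac_hom V s : @hom (localization V) X Y) (nn _ _ s)).
    exact: fe_invl.
  exact: fe_invr.
- pose f' : @hom (localization V) _ _ := f.
  pose g' : @hom (localization V) _ _ := g.
  apply: heq_trans (comp_heqr _ (fmap_comp F f' g')) _.
  apply: heq_trans (comp_heql _ (heq_sym (fmap_comp G f' g'))).
  apply: heq_trans (compA _ _ _) _; apply: heq_trans (comp_heql _ IHf) _.
  apply: heq_trans (heq_sym (compA _ _ _)) _.
  by apply: heq_trans (compA _ _ _); exact: comp_heqr.
Qed.

Section LocalizedUnit.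
Variables (C D : category).
Variables (V : forall X Y : C, hom X Y -> Prop).
Variables (W : forall X Y : D, hom X Y -> Prop).
Variables (F : functor C D) (G : functor D C).
Hypothesis FW : forall (X Y : C) (f : hom X Y), V f -> W (fmap F f).
Hypothesis GV : forall (X Y : D) (f : hom X Y), W f -> V (fmap G f).

Lemma loc_counit (u : forall X : C, hom (G (F X)) X) :
  (forall (X Y : C) (f : hom X Y),
     heq (comp (u Y) (fmap G (fmap F f))) (comp f (u X))) ->
  (forall X, V (u X)) ->
  nat_iso (functor_comp (loc_functor GV) (loc_functor FW)) (functor_id _).
Proof.
move=> un uV; apply: (@loc_nat_iso _ (localization V) V
  (functor_comp (loc_functor GV) (loc_functor FW)) (functor_id _)
  (fun X => frac_hom V (u X)) (fun X => frac_inv (uV X))) => [X Y f|X|X].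
- apply: fe_trans (fe_sym (fe_hom_comp _ _ _)) _.
  by apply: fe_trans (fe_hom_comp _ _ _); apply: fe_hom_heq; exact: un.
- exact: fe_invl.
- exact: fe_invr.
Qed.

Lemma loc_unit (u : forall X : C, hom X (G (F X))) :
  (forall (X Y : C) (f : hom X Y),
     heq (comp (u Y) f) (comp (fmap G (fmap F f)) (u X))) ->
  (forall X, V (u X)) ->
  nat_iso (functor_comp (loc_functor GV) (loc_functor FW)) (functor_id _).
Proof.
move=> un uV.
(* The components of [u] point away from the identity functor, so the isomorphism is built in that
   direction and then inverted. *)
suff [n n' nn nl nr] : nat_iso (functor_id _)
    (functor_comp (loc_functor GV) (loc_functor FW)).
  exists n' n => // X Y f; apply: heq_trans (heq_sym (comp_idr _)) _.
  apply: heq_trans (comp_heqr _ (heq_sym (nr X))) _.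
  apply: heq_trans (compA _ _ _) _; apply: comp_heql.
  apply: heq_trans (heq_sym (compA _ _ _)) _.
  apply: heq_trans (comp_heqr _ (heq_sym (nn _ _ f))) _.
  apply: heq_trans (compA _ _ _) _.
  by apply: heq_trans (comp_idl _); apply: comp_heql.
apply: (@loc_nat_iso _ (localization V) V
  (functor_id _) (functor_comp (loc_functor GV) (loc_functor FW))
  (fun X => frac_hom V (u X)) (fun X => frac_inv (uV X))) => [X Y f|X|X].
- apply: fe_trans (fe_sym (fe_hom_comp _ _ _)) _.
  by apply: fe_trans (fe_hom_comp _ _ _); apply: fe_hom_heq; exact: un.
- exact: fe_invl.
- exact: fe_invr.
Qed.

End LocalizedUnit.

(** * Fdim as torsion *)

Section HomogeneousElements.
Variables (k : fieldType) (Q : quiver).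
Local Notation A := (path_alg k Q).
Implicit Types (a b : A) (p : qpath Q).

(** In terms of coefficients, homogeneity passes to sums and multiples at once, with no computation
    of supports. *)
Lemma pa_homogP n a :
  pa_homog n a <-> forall p, plen p != n -> a@_p = 0.
Proof.
split=> [an p pn|a0 p pa]; apply/eqP.
  by rewrite mcoeff_eq0; apply: contraNN pn => /an ->.
by apply: contraTT pa => /a0/eqP; rewrite mcoeff_eq0.
Qed.

Lemma pa_homog0 n : pa_homog n (0 : A).
Proof. by apply/pa_homogP => p _; rewrite mcoeff0. Qed.

Lemma pa_homogD n a b : pa_homog n a -> pa_homog n b -> pa_homog n (a + b).
Proof.
move=> /pa_homogP an /pa_homogP bn; apply/pa_homogP => p pn.
by rewrite mcoeffD an ?bn ?addr0.
Qed.

Lemma pa_homogZ n (c : k) a : pa_homog n a -> pa_homog n (c *: a).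
Proof.
move=> /pa_homogP an; apply/pa_homogP => p pn.
by rewrite mcoeffZ an ?mulr0.
Qed.

Lemma pa_homog_sum n (I : Type) (r : seq I) (P : pred I) (F : I -> A) :
  (forall i, P i -> pa_homog n (F i)) -> pa_homog n (\sum_(i <- r | P i) F i).
Proof.
by move=> Fn; apply: big_ind => //; [exact: pa_homog0 | exact: pa_homogD].
Qed.

Lemma pa_homog_basis p : pa_homog (plen p) (pbasis k p).
Proof.
apply/pa_homogP => q qp; rewrite pbasis.unlock mcoeffU.
by have [pq|_] := eqVneq p q; rewrite ?mulr0n // pq eqxx in qp.
Qed.

Lemma pa_homog1 : pa_homog 0 (1 : A).
Proof. by apply: pa_homog_sum => v _; exact: (@pa_homog_basis (ptriv v)). Qed.

Lemma pa_homog_decomp a : exists (N : nat) (c : nat -> A),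
  (forall m, pa_homog m (c m)) /\ a = \sum_(m < N) c m.
Proof.
pose N := (\max_(p <- msupp a) plen p).+1.
exists N, (fun m => \sum_(p <- msupp a | plen p == m) a@_p *: pbasis k p).
split=> [m|]; first by apply: pa_homog_sum => p /eqP <-; apply/pa_homogZ/pa_homog_basis.
rewrite {1}(path_algE a); under [RHS]eq_bigr do rewrite big_mkcond.
rewrite exchange_big /= big_seq [RHS]big_seq; apply: eq_bigr => p pa.
have pN : (plen p < N)%N by rewrite ltnS; apply: leq_bigmax_seq.
rewrite (bigD1 (Ordinal pN)) //= eqxx big1 ?addr0 // => i.
by rewrite -val_eqE /= eq_sym => /negbTE ->.
Qed.

End HomogeneousElements.

(** * Modules supported in finitely many degrees *)

Section SupportedIn.
Variables (k : fieldType) (Q : quiver) (M : grmod k Q).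
Implicit Types (x y : M) (s t : seq int).

(** For duplicate-free [t], the homogeneous components of [x] vanish outside the degrees in [t]. The
    existential form avoids constructing projections onto the components. *)
Definition supp_in t x := exists c : int -> M,
  (forall i, c i \in gdeg M i) /\ x = \sum_(i <- t) c i.

Lemma supp_inW s t x : uniq s -> uniq t -> {subset s <= t} ->
  supp_in s x -> supp_in t x.
Proof.
move=> us ut st [c [ci ->]]; exists (fun i => if i \in s then c i else 0); split.
  by move=> i; case: ifP => _; [exact: ci | exact: (rpred0 (gdeg M i))].
rewrite -big_mkcond /= -[RHS]big_filter; apply: perm_big.
apply: uniq_perm; rewrite ?filter_uniq // => i; rewrite mem_filter.
by case si: (i \in s) => //=; rewrite st.
Qed.

Lemma supp_in_sum t (n : nat) (F : 'I_n -> M) :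
  (forall j, supp_in t (F j)) -> supp_in t (\sum_j F j).
Proof.
move=> /choice[c cP]; exists (fun i => \sum_j c j i); split.
  by move=> i; apply: rpred_sum => j _; have [ci _] := cP j; exact: ci.
by rewrite exchange_big; apply: eq_bigr => j _; have [_ ->] := cP j.
Qed.

Lemma supp_inZ t (a : path_alg k Q) x :
  pa_homog 0 a -> supp_in t x -> supp_in t (a *: x).
Proof.
move=> a0 [c [ci ->]]; exists (fun i => a *: c i); split=> [i|].
  by have := gdeg_act a0 (ci i); rewrite add0r.
exact: scaler_sumr.
Qed.

Lemma supp_in_notin t i x : uniq t -> i \notin t ->
  supp_in t x -> x \in gdeg M i -> x = 0.
Proof.
(* Putting [- x] in degree [i] turns the expression of [x] into a vanishing sum over [i :: t], whose
   terms are zero by [gdeg_free]. *)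
move=> ut it [c [ci xE]] xi; pose d j := if j == i then - x else c j.
rewrite -[x]opprK; have -> : - x = d i by rewrite /d eqxx.
rewrite (@gdeg_free _ _ M (i :: t) d) ?oppr0 ?mem_head //= ?it //.
  move=> j; rewrite /d; case: eqP => [->|_]; last exact: ci.
  by apply: rpredNr.
rewrite big_cons {1}/d eqxx {1}xE; apply/eqP; rewrite addrC subr_eq0; apply/eqP.
rewrite big_seq [RHS]big_seq; apply: eq_bigr => j jt; rewrite /d.
by case: eqP it => // <-; rewrite jt.
Qed.

(** Take all degrees that occur in the finitely many generators; scalars have degree 0, so linear
    combinations add no new degree. *)
Lemma fin_dim_supp : fin_dim M -> exists2 t, uniq t & forall x, supp_in t x.
Proof.
move=> [n [b bP]].
have /choice[s sP] : forall j, exists s, uniq s /\ supp_in s (b j).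
  move=> j; have [s [c [us ci bE]]] := gdeg_span_uniq (b j).
  by exists s; split=> //; exists c.
exists (undup (flatten [seq s j | j <- enum 'I_n])) => [|x]; first exact: undup_uniq.
have [c ->] := bP x; apply: supp_in_sum => j.
apply: supp_inZ; first by apply: pa_homogZ; exact: pa_homog1.
have [us] := sP j; apply: supp_inW (undup_uniq _) _ => // i si.
rewrite mem_undup; apply/flattenP; exists (s j) => //.
by apply: map_f; rewrite mem_enum.
Qed.

End SupportedIn.

Section Torsion.
Variables (k : fieldType) (Q : quiver).
Local Notation A := (path_alg k Q).

(** Homogeneous elements stand in for paths of length at least [n]: they are what a graded map
    preserves, whereas it may send a path to a combination of paths. *)
Definition torsion (M : lmodType A) (x : M) : Prop :=
  exists n, forall m (a : A), (n <= m)%N -> pa_homog m a -> a *: x = 0.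

Lemma torsion_sum (M : lmodType A) (I : eqType) (r : seq I) (F : I -> M) :
  (forall i, torsion (F i)) -> torsion (\sum_(i <- r) F i).
Proof.
move=> /choice[n nP]; exists (\max_(i <- r) n i) => m a nm am.
rewrite scaler_sumr big_seq big1 // => i ir; apply: nP am.
by apply: leq_trans nm; exact: leq_bigmax_seq.
Qed.

(* A finite-dimensional graded module has only finitely many nonzero degrees. *)
Lemma fin_dim_torsion (M : grmod k Q) (x : M) : fin_dim M -> torsion x.
Proof.
(* For [m] beyond this bound, [m + i] exceeds every degree in [t], so the part of [M] in degree
   [m + i] is zero. *)
move=> /fin_dim_supp[t ut tP]; have [s [c [ci ->]]] := gdeg_span x.
apply: torsion_sum => i; exists (\sum_(j <- t) `|j| + `|i|).+1%N => m a nm am.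
have := gdeg_act am (ci i); apply: supp_in_notin (ut) _ (tP _).
apply: contraTN nm => mit; rewrite -ltnNge ltnS (big_rem (m%:Z + i)) //=.
lia.
Qed.

End Torsion.

Lemma scale_assoc (k : fieldType) (Q : quiver) (M : lmodType (path_alg k Q))
    (c : k) (a : path_alg k Q) (x : M) :
  (c *: a) *: x = (c *: (1 : path_alg k Q)) *: (a *: x).
Proof.
have -> : c *: a = (c *: (1 : path_alg k Q)) * a.
  by rewrite -path_alg_scalerAl mul1r.
by rewrite scalerA.
Qed.

(** * The submodule generated by a homogeneous element *)

Section CyclicSubmodule.
Variables (k : fieldType) (Q : quiver) (M : grmod k Q) (z : M) (d : int).
Hypothesis zd : z \in gdeg M d.
Local Notation A := (path_alg k Q).

Definition cyclic_pred : {pred M} := fun y => `[< exists a : A, y = a *: z >].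

Let cyclic_closed : subsemimod_closed cyclic_pred.
Proof.
split; first split.
- by apply/asboolP; exists 0; rewrite scale0r.
- move=> _ _ /asboolP[a ->] /asboolP[b ->]; apply/asboolP.
  by exists (a + b); rewrite scalerDl.
- move=> a _ /asboolP[b ->]; apply/asboolP.
  by exists (a * b); rewrite scalerA.
Qed.
HB.instance Definition _ :=
  GRing.isSubSemiModClosed.Build A M cyclic_pred cyclic_closed.

Let cyclic_homog (x : M) : x \in (cyclic_pred : submodClosed M) ->
  exists (s : seq int) (c : int -> M),
    [/\ forall i, c i \in gdeg M i,
        forall i, c i \in (cyclic_pred : submodClosed M) & x = \sum_(i <- s) c i].
Proof.
move=> /asboolP[a ->]; have [N [c [cm ->]]] := pa_homog_decomp a.
(* The component of [a *: z] in degree [i] comes from the part of [a] of degree [i - d], hence the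
   value 0 for [i] below [d]. *)
exists [seq m%:Z + d | m <- iota 0 N],
  (fun i => if i - d is Posz m then c m *: z else 0); split=> [i|i|].
- case E: (i - d) => [m|m]; last exact: (rpred0 (gdeg M i)).
  by rewrite -(subrK d i) E; apply: gdeg_act.
- apply/asboolP; case: (i - d) => [m|m]; first by exists (c m).
  by exists 0; rewrite scale0r.
- rewrite big_map scaler_suml -(big_mkord xpredT (fun m => c m *: z)).
  by rewrite /index_iota subn0; apply: eq_bigr => m _; rewrite addrK.
Qed.

Definition cyclic : grsub M := GrSub cyclic_homog.

Lemma mem_cyclic : z \in gscar cyclic.
Proof. by apply/asboolP; exists 1; rewrite scale1r. Qed.

(** Paths of length at least [n] kill [z], and [Q], being finite, has only finitely many shorter
    ones; their multiples of [z] span. *)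
Lemma fin_dim_cyclic : torsion z -> fin_dim (subGr cyclic).
Proof.
(* [T] is a finite type that encodes all paths of length at most [n]; its elements that are not
   paths contribute [b i = 0]. *)
move=> [n nP]; pose T := (vert Q * n.-bseq (arr Q))%type.
have cycP (a : A) : a *: z \in gscar cyclic by apply/asboolP; exists a.
pose y (a : A) : subGr cyclic := exist _ (a *: z) (cycP a).
pose b (i : T) : A := if insub (i.1, val i.2) is Some p then pbasis k p else 0.
suff spanT (a : A) : exists c : T -> k, a *: z = \sum_i (c i *: (1 : A)) *: (b i *: z).
  exists #|{: T}|, (fun i => y (b (enum_val i))) => x.
  have /asboolP[a xE] := valP x; have [c cE] := spanT a.
  exists (fun i => c (enum_val i)); apply: val_inj; rewrite raddf_sum /= xE cE.
  by rewrite (reindex _ (onW_bij _ (enum_val_bij {: T}))).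
elim/path_alg_ind: a => [|e p a [c IHa]].
  exists (fun=> 0); rewrite scale0r big1 // => i _.
  by rewrite scale0r scale0r.
have [u uE] : exists u : A, u = e *: pbasis k p by eexists.
have up : pa_homog (plen p) u by rewrite uE; apply/pa_homogZ/pa_homog_basis.
have uz : u *: z = (e *: (1 : A)) *: (pbasis k p *: z).
  by rewrite uE; exact: scale_assoc.
rewrite -uE scalerDl {}IHa.
have [np|pn] := leqP n (plen p).
  by exists c; rewrite (nP _ _ np up) add0r.
pose i0 : T := (psrc p, Bseq (ltnW pn)).
have bi0 : b i0 = pbasis k p.
  rewrite /b; suff -> : (i0.1, val i0.2) = val p by rewrite valK.
  by rewrite /= /psrc /parrs; case: (pval p).
exists (fun i => c i + (if i == i0 then e else 0)).
under [RHS]eq_bigr do rewrite scalerDl scalerDl.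
rewrite big_split /= addrC; congr (_ + _); rewrite (bigD1 i0) //= eqxx.
rewrite big1 ?addr0 => [|i /negbTE ->]; last by rewrite !scale0r.
by rewrite bi0.
Qed.

End CyclicSubmodule.

Section FdimTorsion.
Variables (k : fieldType) (Q : quiver).
Local Notation A := (path_alg k Q).

(* The images of distinct components under a homogeneous [a] have distinct
   degrees, so they vanish separately. *)
Lemma torsion_component (M : grmod k Q) (s : seq int) (c : int -> M) (i : int) :
  uniq s -> (forall i, c i \in gdeg M i) -> i \in s ->
  torsion (\sum_(i <- s) c i) -> torsion (c i).
Proof.
move=> us ci si [n nP]; exists n => m a nm am.
have inj : injective (fun j : int => m%:Z + j) by exact: addrI.
have := @gdeg_free _ _ M [seq m%:Z + j | j <- s] (fun j => a *: c (j - m%:Z)).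
rewrite map_inj_uniq // => /(_ us) H.
have := H _ _ (m%:Z + i); rewrite addrAC subrr add0r; apply.
- by move=> j; have := gdeg_act am (ci (j - m%:Z)); rewrite [m%:Z + _]addrC subrK.
- rewrite big_map -[RHS](nP _ _ nm am) scaler_sumr; apply: eq_bigr => j _.
  by rewrite addrAC subrr add0r.
- by rewrite mem_map.
Qed.

(** Torsion in a finite-dimensional submodule is torsion in [M], and sums of torsion elements are
    torsion. Conversely, the homogeneous components of a torsion element are torsion, so each
    generates a finite-dimensional graded submodule. *)
Lemma FdimP (M : grmod k Q) : Fdim M <-> forall x : M, torsion x.
Proof.
split=> [MF x|Mt x].
  have [n [S [y [yS ->]]]] := MF x; apply: torsion_sum => i.
  have [Sfin yi] := yS i.
  have [N NP] := fin_dim_torsion (exist _ (y i) yi : subGr (S i)) Sfin.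
  by exists N => m a Nm am; have /(congr1 val) := NP _ _ Nm am.
have [s [c [us ci xE]]] := gdeg_span_uniq x.
exists (size s), (fun i => cyclic (ci (tnth (in_tuple s) i))).
exists (fun i => c (tnth (in_tuple s) i)); split; last by rewrite xE big_tnth.
move=> i; split; last exact: mem_cyclic.
apply: fin_dim_cyclic; apply: torsion_component us ci (mem_tnth i (in_tuple s)) _.
by rewrite -xE.
Qed.

(** This is [FdimP] for kernel and cokernel: [a] kills the class of [y] in the cokernel exactly when
    [a *: y] lies in the image. *)
Lemma Fdim_isoP (M N : grmod k Q) (f : grhom M N) :
  Fdim_iso (f : @hom (Gr k Q) M N) <->
    (forall x : M, f x = 0 -> torsion x) /\
    (forall y : N, exists n, forall m (a : A), (n <= m)%N -> pa_homog m a ->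
       exists x, f x = a *: y).
Proof.
rewrite /Fdim_iso !FdimP; split=> [[kf cf]|[kf cf]]; split.
- move=> x fx; have xk : x \in gscar (grker f) by apply/eqP.
  have [n nP] := kf (exist _ x xk).
  by exists n => m a nm am; have /(congr1 val) := nP _ _ nm am.
- move=> y; have [n nP] := cf (quotproj (grim f) y); exists n => m a nm am.
  have := nP _ _ nm am; rewrite -linearZ -(raddf0 (quotproj (grim f))).
  by move=> /quotproj_eq; rewrite subr0 => /asboolP.
- move=> x; have /eqP/kf[n nP] := valP x.
  by exists n => m a nm am; apply: val_inj; exact: nP nm am.
- move=> u; have [y <-] := quotproj_surj u; have [n nP] := cf y.
  exists n => m a nm am; rewrite -linearZ -(raddf0 (quotproj (grim f))).
  by apply/quotproj_eq; rewrite subr0; apply/asboolP; exact: nP nm am.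
Qed.

End FdimTorsion.

(** * Pulling modules back along non-unital graded maps *)

(* Not required to preserve 1. *)
Record graded_hom (k : fieldType) (P Q : quiver) := GradedHom {
  gh_fun :> path_alg k P -> path_alg k Q;
  ghD : forall a b, gh_fun (a + b) = gh_fun a + gh_fun b;
  ghM : forall a b, gh_fun (a * b) = gh_fun a * gh_fun b;
  gh_homog : forall n a, pa_homog n a -> pa_homog n (gh_fun a) }.

Section Pull.
Variables (k : fieldType) (P Q : quiver) (phi : graded_hom k P Q).
Local Notation A := (path_alg k P).
Local Notation B := (path_alg k Q).

Section Module.
Variable M : lmodType B.

(** By [ghM], [phi 1] is idempotent, so these fixed points form [phi 1 *: M], the part of [M] on
    which [1] acts through [phi] as the identity. *)
Definition pull_pred : {pred M} := fun x => phi 1 *: x == x.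

Let pull_closed : zmod_closed pull_pred.
Proof.
split=> [|x y /eqP xP /eqP yP]; first by rewrite unfold_in /pull_pred scaler0.
by rewrite unfold_in /pull_pred scalerBr xP yP.
Qed.
HB.instance Definition _ := GRing.isZmodClosed.Build M pull_pred pull_closed.

Definition pull : Type := {x : M | x \in pull_pred}.
HB.instance Definition _ := [isSub of pull for @sval M (fun x => x \in pull_pred)].
HB.instance Definition _ := [Choice of pull by <:].
HB.instance Definition _ := [SubChoice_isSubZmodule of pull by <:].

Lemma pull_mem (a : A) (x : M) : phi a *: x \in pull_pred.
Proof. by rewrite unfold_in /pull_pred scalerA -ghM mul1r. Qed.

Definition pull_in (a : A) (x : M) : pull := exist _ (phi a *: x) (pull_mem a x).

Lemma val_pull1 (x : pull) : phi 1 *: val x = val x.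
Proof. exact/eqP/(valP x). Qed.

Definition pull_scale (a : A) (x : pull) : pull := pull_in a (val x).

Let scaleA a b x : pull_scale a (pull_scale b x) = pull_scale (a * b) x.
Proof. by apply: val_inj; rewrite /= scalerA -ghM. Qed.

Let scale1 : left_id 1 pull_scale.
Proof. by move=> x; apply: val_inj; exact: val_pull1. Qed.

Let scaleDr : right_distributive pull_scale +%R.
Proof. by move=> a x y; apply: val_inj; rewrite /= scalerDr. Qed.

Let scaleDl x : {morph pull_scale^~ x : a b / a + b}.
Proof. by move=> a b; apply: val_inj; rewrite /= ghD scalerDl. Qed.

HB.instance Definition _ := GRing.Zmodule_isLmodule.Build A pull
  scaleA scale1 scaleDr scaleDl.

Lemma val_pullZ (a : A) (x : pull) : val (a *: x) = phi a *: val x.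
Proof. by []. Qed.

End Module.

Section Graded.
Variable M : grmod k Q.

Definition pull_deg (i : int) : {pred pull M} := fun x => val x \in gdeg M i.

Let pull_deg_closed i : zmod_closed (pull_deg i).
Proof.
split=> [|x y xi yi]; first by rewrite unfold_in; exact: (rpred0 (gdeg M i)).
by rewrite unfold_in /pull_deg raddfB; exact: (rpredB xi yi).
Qed.
HB.instance Definition _ i :=
  GRing.isZmodClosed.Build (pull M) (pull_deg i) (pull_deg_closed i).

Let pull_deg_span (x : pull M) : exists (s : seq int) (c : int -> pull M),
  (forall i, c i \in (pull_deg i : zmodClosed _)) /\ x = \sum_(i <- s) c i.
Proof.
(* Multiplying by [phi 1], which has degree 0, moves the components into the pullback without
   changing their degrees. *)
have [s [c [ci xE]]] := gdeg_span (val x); exists s, (fun i => pull_in 1 (c i)).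
split=> [i|].
  have := gdeg_act (@gh_homog _ _ _ phi _ _ (@pa_homog1 k P)) (ci i).
  by rewrite add0r unfold_in.
by apply: val_inj; rewrite raddf_sum /= -scaler_sumr -xE val_pull1.
Qed.

Let pull_deg_free (s : seq int) (c : int -> pull M) : uniq s ->
  (forall i, c i \in (pull_deg i : zmodClosed _)) -> \sum_(i <- s) c i = 0 ->
  forall i, i \in s -> c i = 0.
Proof.
move=> us ci c0 i si; apply: val_inj; rewrite raddf0.
apply: (@gdeg_free _ _ M s (fun i => val (c i))) => //.
by rewrite -raddf_sum c0 raddf0.
Qed.

Let pull_deg_act (n : nat) (i : int) (a : A) (x : pull M) : pa_homog n a ->
  x \in (pull_deg i : zmodClosed _) ->
  a *: x \in (pull_deg (n%:Z + i) : zmodClosed _).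
Proof.
move=> an xi; rewrite unfold_in /pull_deg val_pullZ; apply: gdeg_act xi.
exact: gh_homog.
Qed.

Definition pullGr : grmod k P := GrMod pull_deg_span pull_deg_free pull_deg_act.

End Graded.

Section Morphism.
Variables (M N : grmod k Q) (f : grhom M N).

Lemma pull_map_mem (x : pullGr M) : f (val x) \in @pull_pred N.
Proof. by rewrite unfold_in /pull_pred -linearZ val_pull1. Qed.

Definition pull_map (x : pullGr M) : pullGr N := exist _ (f (val x)) (pull_map_mem x).

Let pull_map_linear : linear pull_map.
Proof.
by move=> a x y; apply: val_inj; rewrite /= !(raddfD, linearZ) /= linearZ.
Qed.
HB.instance Definition _ :=
  GRing.isLinear.Build A (pullGr M) (pullGr N) _ pull_map pull_map_linear.

Let pull_map_deg i (x : pullGr M) :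
  x \in gdeg (pullGr M) i -> (pull_map : {linear _ -> _}) x \in gdeg (pullGr N) i.
Proof. by move=> xi; apply: (@gfun_deg _ _ M N f i (val x)). Qed.

Definition pull_hom : grhom (pullGr M) (pullGr N) := GrHom pull_map_deg.

End Morphism.

Definition pull_functor : functor (Gr k Q) (Gr k P).
Proof.
apply: (@Functor (Gr k Q) (Gr k P) pullGr pull_hom).
- by move=> M N f g fg x; apply: val_inj; exact: fg.
- by move=> M x; apply: val_inj.
- by move=> M N L f g x; apply: val_inj.
Defined.

(** The bounds carry over because [phi] preserves degrees. A preimage [x] of [phi a *: val y] is
    replaced by [phi 1 *: x], which lies in the pullback and has the same image since
    [phi 1 * phi a = phi a]. *)
Lemma pull_Fdim_iso (M N : Gr k Q) (f : hom M N) :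
  Fdim_iso f -> Fdim_iso (fmap pull_functor f).
Proof.
move=> /Fdim_isoP[kf cf]; apply/Fdim_isoP; split=> [x|y].
  move=> /(congr1 val)/kf[n nP]; exists n => m a nm am; apply: val_inj.
  by rewrite val_pullZ; apply: nP nm _; exact: gh_homog.
have [n nP] := cf (val y); exists n => m a nm am.
have [x fx] := nP _ _ nm (@gh_homog _ _ _ phi _ _ am).
exists (pull_in 1 x); apply: val_inj.
by rewrite /= linearZ /= fx scalerA -ghM mul1r.
Qed.

End Pull.

(** * Comparison of a module with its double pullback *)

Section DoublePull.
Variables (k : fieldType) (P Q : quiver).
Variables (phi : graded_hom k P Q) (psi : graded_hom k Q P).
Local Notation A := (path_alg k P).

Section Objects.
Variable M : grmod k P.
Local Notation PPM := (pullGr phi (pullGr psi M)).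

Lemma val2_inj : injective (fun x : PPM => val (val x)).
Proof. exact: inj_comp val_inj val_inj. Qed.

Lemma val2Z (a : A) (x : PPM) : val (val (a *: x)) = psi (phi a) *: val (val x).
Proof. by []. Qed.

Lemma val2_1 (x : PPM) : psi 1 *: val (val x) = val (val x).
Proof. exact: val_pull1. Qed.

Lemma scale_val2 (a : A) (x : PPM) :
  psi (phi a) = a * psi 1 -> psi (phi a) *: val (val x) = a *: val (val x).
Proof. by move=> ->; rewrite -scalerA val2_1. Qed.

Section Counit.
Hypothesis psi_phi : forall a : A, psi (phi a) = a * psi 1.

(** Write [e] for [psi 1]. By [psi_phi], [a * e = e * a * e], so [e M] is a submodule of [M]. It is
    the double pullback, and this map is its inclusion, linear because [a] and [a * e] agree on
    [e M]. *)
Definition counit_fun (x : PPM) : M := val (val x).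

Let counit_linear : linear counit_fun.
Proof. by move=> a x y; rewrite /counit_fun /= scale_val2. Qed.
HB.instance Definition _ :=
  GRing.isLinear.Build A PPM M _ counit_fun counit_linear.

Let counit_deg i (x : PPM) :
  x \in gdeg PPM i -> (counit_fun : {linear _ -> _}) x \in gdeg M i.
Proof. by []. Qed.

Definition counit : grhom PPM M := GrHom counit_deg.

(** The inclusion has no kernel; for [a] of large degree, [a *: y = e *: (a *: y)] lies in [e M], so
    the cokernel is torsion. *)
Lemma counit_Fdim_iso :
  (exists n, forall m (a : A), (n <= m)%N -> pa_homog m a -> psi 1 * a = a) ->
  Fdim_iso (counit : @hom (Gr k P) PPM M).
Proof.
move=> [n nP]; apply/Fdim_isoP; split=> [x x0|y].
  have -> : x = 0 by apply: val2_inj.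
  by exists 0 => m a _ _; rewrite scaler0.
exists n => m a nm am; exists (pull_in phi 1 (pull_in psi 1 (a *: y))).
rewrite /= /counit_fun /=.
by rewrite psi_phi mul1r [_ *: (a *: y)]scalerA (nP _ _ nm am) scalerA (nP _ _ nm am).
Qed.

End Counit.

Section Unit.
Hypothesis psi_phi : forall a : A, psi (phi a) = psi 1 * a.

(** Dually, now [e * a = e * a * e], so [(1 - e) M] is a submodule and [y] maps to [e y] in the
    quotient [e M]. *)
Definition unit_fun (y : M) : PPM := pull_in phi 1 (pull_in psi 1 y).

Lemma val2_unit y : val (val (unit_fun y)) = psi 1 *: y.
Proof. by rewrite /unit_fun /= psi_phi mulr1 scalerA -ghM mulr1. Qed.

Lemma psi1_mul (a : A) : psi 1 * a * psi 1 = psi 1 * a.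
Proof. by rewrite -psi_phi -ghM mulr1. Qed.

Let unit_linear : linear unit_fun.
Proof.
move=> a x y; apply: val2_inj; rewrite val2_unit.
transitivity (val (val (a *: unit_fun x)) + val (val (unit_fun y))) => //.
rewrite val2Z !val2_unit psi_phi scalerDr; congr (_ + _).
by rewrite !scalerA psi1_mul.
Qed.
HB.instance Definition _ :=
  GRing.isLinear.Build A M PPM _ unit_fun unit_linear.

Let unit_deg i (y : M) :
  y \in gdeg M i -> (unit_fun : {linear _ -> _}) y \in gdeg PPM i.
Proof.
move=> yi; have := gdeg_act (@gh_homog _ _ _ psi _ _ (@pa_homog1 k Q)) yi.
by rewrite add0r -val2_unit.
Qed.

Definition unit_hom : grhom M PPM := GrHom unit_deg.

(** If [e y = 0], then [a *: y = (a * e) *: y = 0] for [a] of large degree, so the kernel is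
    torsion. The map is onto, since [e] fixes [e M]. *)
Lemma unit_Fdim_iso :
  (exists n, forall m (a : A), (n <= m)%N -> pa_homog m a -> a * psi 1 = a) ->
  Fdim_iso (unit_hom : @hom (Gr k P) M PPM).
Proof.
move=> [n nP]; apply/Fdim_isoP; split=> [y /(congr1 (val \o val))|x].
  rewrite /= -/(unit_fun y) => y0; exists n => m a nm am.
  rewrite -(nP _ _ nm am) -scalerA -val2_unit.
  by rewrite [X in a *: X]y0 scaler0.
exists 0 => m a _ _; exists (val (val (a *: x))).
by apply: val2_inj; rewrite [LHS]val2_unit val2_1.
Qed.

End Unit.
End Objects.
End DoublePull.

Section PullEquivalence.
Variables (k : fieldType) (P Q : quiver).
Variables (phi : graded_hom k P Q) (psi : graded_hom k Q P).

Lemma pull_counit :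
  (forall a, psi (phi a) = a * psi 1) ->
  (exists n, forall m a, (n <= m)%N -> pa_homog m a -> psi 1 * a = a) ->
  nat_iso
    (functor_comp (loc_functor (@pull_Fdim_iso k P Q phi))
                  (loc_functor (@pull_Fdim_iso k Q P psi)))
    (functor_id (QGr k P)).
Proof.
move=> psi_phi psi1; apply: (@loc_counit (Gr k P) (Gr k Q) (@Fdim_iso k P) (@Fdim_iso k Q)
  (pull_functor psi) (pull_functor phi) _ _ (fun M => counit M psi_phi)).
  by move=> M N f x.
by move=> M; exact: counit_Fdim_iso.
Qed.

Lemma pull_unit :
  (forall a, psi (phi a) = psi 1 * a) ->
  (exists n, forall m a, (n <= m)%N -> pa_homog m a -> a * psi 1 = a) ->
  nat_iso
    (functor_comp (loc_functor (@pull_Fdim_iso k P Q phi))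
                  (loc_functor (@pull_Fdim_iso k Q P psi)))
    (functor_id (QGr k P)).
Proof.
move=> psi_phi psi1; apply: (@loc_unit (Gr k P) (Gr k Q) (@Fdim_iso k P) (@Fdim_iso k Q)
  (pull_functor psi) (pull_functor phi) _ _ (fun M => unit_hom M psi_phi)).
  move=> M N f y; apply: val2_inj; rewrite [LHS](val2_unit psi_phi).
  transitivity (f (val (val (unit_fun phi psi y)))) => //.
  by rewrite (val2_unit psi_phi) linearZ.
by move=> M; exact: unit_Fdim_iso.
Qed.

End PullEquivalence.

Lemma QGr_equivalent (k : fieldType) (P Q : quiver)
    (phi : graded_hom k P Q) (psi : graded_hom k Q P) :
  (forall a, psi (phi a) = a) ->
  (* the removed vertex is a source, respectively a sink *)
  ((forall b, phi (psi b) = b * phi 1) /\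
   (exists n, forall m b, (n <= m)%N -> pa_homog m b -> phi 1 * b = b)) \/
  ((forall b, phi (psi b) = phi 1 * b) /\
   (exists n, forall m b, (n <= m)%N -> pa_homog m b -> b * phi 1 = b)) ->
  equivalent_categories (QGr k Q) (QGr k P).
Proof.
move=> psiK H; exists (loc_functor (@pull_Fdim_iso k P Q phi)).
exists (loc_functor (@pull_Fdim_iso k Q P psi)); split.
  case: H => [] [phi_psi phi1]; constructor; first exact: pull_counit.
  exact: pull_unit.
(* [psi] is unital, since [psi 1 = psi 1 * psi (phi 1) = psi (phi 1) = 1]. So on [QGr k P] the
   inclusion case applies with idempotent 1, whatever the removed vertex. *)
have psi1 : psi 1 = 1 by have := ghM psi 1 (phi 1); rewrite mul1r psiK mulr1.
constructor; apply: pull_counit => [a|]; first by rewrite psiK psi1 mulr1.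
by exists 0%N => m a _ _; rewrite psi1 mul1r.
Qed.

(** * Path algebras of full subquivers *)

Section KLinear.
Variables (k : fieldType) (Q P : quiver).
Implicit Types L : path_alg k Q -> path_alg k P.

(** A predicate on plain functions, so that one-sided multiplications and composites are covered
    without bundling them. *)
Definition klinear L : Prop :=
  (forall a b, L (a + b) = L a + L b) /\ (forall (c : k) a, L (c *: a) = c *: L a).

Lemma klinear0 L : klinear L -> L 0 = 0.
Proof. by move=> [_ LZ]; have := LZ 0 0; rewrite !scale0r. Qed.

Lemma klinear_eq_homog L L' n : klinear L -> klinear L' ->
  (forall p, plen p = n -> L (pbasis k p) = L' (pbasis k p)) ->
  forall a, pa_homog n a -> L a = L' a.
Proof.
move=> KL KL' E a an; have [LD LZ] := KL; have [LD' LZ'] := KL'.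
rewrite (path_algE a) (big_morph L LD (klinear0 KL)).
rewrite (big_morph L' LD' (klinear0 KL')) big_seq [RHS]big_seq.
by apply: eq_bigr => p /an pn; rewrite LZ LZ' E.
Qed.

Lemma klinear_eq L L' : klinear L -> klinear L' ->
  (forall p, L (pbasis k p) = L' (pbasis k p)) -> L =1 L'.
Proof.
move=> [LD LZ] [LD' LZ'] E; elim/path_alg_ind => [|c p a IHa].
  by rewrite !klinear0.
by rewrite LD LD' LZ LZ' E IHa.
Qed.

Lemma klinear_mull b L : klinear L -> klinear (fun a => b * L a).
Proof.
move=> [LD LZ]; split=> [x y|c x]; first by rewrite LD mulrDr.
by rewrite LZ path_alg_scalerAr.
Qed.

Lemma klinear_mulr b L : klinear L -> klinear (fun a => L a * b).
Proof.
move=> [LD LZ]; split=> [x y|c x]; first by rewrite LD mulrDl.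
by rewrite LZ path_alg_scalerAl.
Qed.

End KLinear.

Lemma klinear_id (k : fieldType) (Q : quiver) : klinear (@id (path_alg k Q)).
Proof. by []. Qed.

Lemma klinear_comp (k : fieldType) (Q P R : quiver)
    (L : path_alg k P -> path_alg k R) (K : path_alg k Q -> path_alg k P) :
  klinear L -> klinear K -> klinear (L \o K).
Proof.
by move=> [LD LZ] [KD KZ]; split=> [x y|c x] /=; rewrite ?KD ?LD ?KZ ?LZ.
Qed.

(* Linear extension of [h]; locked for the same reason as [pa_mul]. *)
HB.lock Definition lext (k : fieldType) (Q P : quiver)
    (h : qpath Q -> path_alg k P) (a : path_alg k Q) : path_alg k P :=
  \sum_(p <- msupp a) a@_p *: h p.

Section LinearExtension.
Variables (k : fieldType) (Q P : quiver) (h : qpath Q -> path_alg k P).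
Implicit Types (a b : path_alg k Q) (p q : qpath Q).

Lemma lextEw (d : {fset qpath Q}) a :
  (msupp a `<=` d)%fset -> lext h a = \sum_(p <- d) a@_p *: h p.
Proof.
move=> ad; rewrite lext.unlock (big_fset_incl _ ad) //= => p _ /mcoeff_outdom ->.
by rewrite scale0r.
Qed.

Lemma lextD a b : lext h (a + b) = lext h a + lext h b.
Proof.
pose d := (msupp a `|` msupp b)%fset.
rewrite (@lextEw d) ?msuppD_le // (@lextEw d a) ?fsubsetUl //.
rewrite (@lextEw d b) ?fsubsetUr // -big_split /=.
by apply: eq_bigr => p _; rewrite mcoeffD scalerDl.
Qed.

Lemma lextZ (c : k) a : lext h (c *: a) = c *: lext h a.
Proof.
rewrite (@lextEw (msupp a)) ?msuppZ_le // lext.unlock scaler_sumr.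
by apply: eq_bigr => p _; rewrite mcoeffZ scalerA.
Qed.

Lemma klinear_lext : klinear (lext h).
Proof. by split; [exact: lextD | exact: lextZ]. Qed.

Lemma lext0 : lext h 0 = 0.
Proof. exact: klinear0 klinear_lext. Qed.

Lemma lext_basis p : lext h (pbasis k p) = h p.
Proof.
rewrite (@lextEw [fset p]%fset); last by rewrite pbasis.unlock; exact: msuppU_le.
by rewrite big_seq_fset1 pbasis.unlock mcoeffUU scale1r.
Qed.

Lemma lext_sum (I : Type) (r : seq I) (F : I -> path_alg k Q) :
  lext h (\sum_(i <- r) F i) = \sum_(i <- r) lext h (F i).
Proof. exact: (big_morph _ lextD lext0). Qed.

Hypothesis hM : forall p q, h p * h q = lext h (pprod k p q).

Lemma lextM a b : lext h (a * b) = lext h a * lext h b.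
Proof.
move: a; apply: klinear_eq => [||p].
- exact: klinear_comp klinear_lext (klinear_mulr b (klinear_id k Q)).
- exact: klinear_mulr klinear_lext.
move: b; apply: klinear_eq => [||q].
- exact: klinear_comp klinear_lext (klinear_mull (pbasis k p) (klinear_id k Q)).
- exact: klinear_mull klinear_lext.
by rewrite path_algM_basis !lext_basis hM.
Qed.

Hypothesis h_homog : forall p, pa_homog (plen p) (h p).

Lemma lext_homog n a : pa_homog n a -> pa_homog n (lext h a).
Proof.
move=> an; rewrite lext.unlock big_seq; apply: pa_homog_sum => p /an <-.
exact/pa_homogZ/h_homog.
Qed.

Definition lext_hom : graded_hom k Q P := GradedHom lextD lextM lext_homog.

End LinearExtension.

(** * Extending paths along a full embedding, and the retraction *)

Section FullEmbedding.
Variables (k : fieldType) (P Q : quiver).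
Variables (f : vert P -> vert Q) (g : arr P -> arr Q).
Hypotheses (f_inj : injective f) (g_inj : injective g).
Hypotheses (g_src : forall a, asrc (g a) = f (asrc a))
  (g_tgt : forall a, atgt (g a) = f (atgt a)).
Hypothesis full : forall a v w, asrc a = f v -> atgt a = f w -> exists b, g b = a.

Lemma is_path_map v s : is_path (f v) (map g s) = is_path v s.
Proof. by elim: s v => //= a s IHs v; rewrite g_src g_tgt IHs inj_eq. Qed.

Definition emb (p : qpath P) : qpath Q :=
  @QPath Q (f (psrc p), map g (parrs p)) (etrans (is_path_map _ _) (pvalP p)).

Lemma emb_inj : injective emb.
Proof.
move=> [[v s] vs] [[w t] wt] /(congr1 val) [/f_inj + /(inj_map g_inj)].
by rewrite /psrc /parrs /= => vw st; apply: val_inj; rewrite /= vw st.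
Qed.

Lemma psrc_emb p : psrc (emb p) = f (psrc p).
Proof. by []. Qed.

Lemma ptgt_emb p : ptgt (emb p) = f (ptgt p).
Proof.
rewrite /ptgt /parrs /= -map_comp -(last_map f) -map_comp.
by congr last; apply: eq_map => a /=; rewrite g_tgt.
Qed.

Lemma pcomp_emb p q : pcomp (emb p) (emb q) = omap emb (pcomp p q).
Proof.
have [e|ne] := eqVneq (psrc p) (ptgt q); last first.
  by rewrite !pcomp_none // psrc_emb ptgt_emb inj_eq.
have [r -> rE] := pcomp_arrs e.
have [|r' -> rE'] := @pcomp_arrs _ (emb p) (emb q).
  by rewrite psrc_emb ptgt_emb e.
congr Some; apply: val_inj; rewrite /= rE'.
by rewrite /psrc /parrs /= rE map_cat.
Qed.

(** Lift arrow by arrow: each source is the start or the previous target, so both ends of every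
    arrow lie in the image and [full] applies. *)
Lemma path_lift q v : psrc q = f v ->
  (forall a, a \in parrs q -> exists w, atgt a = f w) -> exists p, emb p = q.
Proof.
case: q => [[u s] vs]; rewrite /psrc /parrs /= => uv st; subst u.
suff [t vt tE] : exists2 t, is_path v t & map g t = s.
  by exists (@QPath P (v, t) vt); apply: val_inj; rewrite /= /psrc /parrs /= tE.
elim: s v {vs} (vs : is_path (f v) s) st => [|a s IHs] v /=; first by exists [::].
move=> /andP[/eqP av ps] st; have [w aw] := st a (mem_head _ _).
have [b ba] := full av aw; rewrite aw in ps.
have [|t wt tE] := IHs w ps; first by move=> c cs; apply: st; rewrite inE cs orbT.
exists (b :: t); rewrite /= ?ba ?tE //.
apply/andP; split; first by rewrite -(inj_eq f_inj) -g_src ba av.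
by rewrite -is_path_map -g_tgt ba aw is_path_map.
Qed.

(* A path of P, seen in Q, factors only into paths of P; this makes [pret]
   multiplicative. *)
Lemma emb_pcomp p q r : pcomp p q = Some (emb r) ->
  exists p' q', p = emb p' /\ q = emb q'.
Proof.
rewrite /pcomp; case: eqP => // pq; case: insubP => // x _ xE [xr].
have {x xr xE} [qs qp] : psrc q = f (psrc r) /\ parrs q ++ parrs p = map g (parrs r).
  by move: xE; rewrite xr /= => -[-> ->].
have qpt a : a \in parrs q ++ parrs p -> exists w, atgt a = f w.
  by rewrite qp => /mapP[b _ ->]; exists (atgt b).
have [|q' qE] := path_lift qs; first by move=> a aq; apply: qpt; rewrite mem_cat aq.
have ps : psrc p = f (ptgt q') by rewrite pq -qE ptgt_emb.
have [|p' pE] := path_lift ps; first by move=> a ap; apply: qpt; rewrite mem_cat ap orbT.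
by exists p', q'.
Qed.

Definition pemb (p : qpath P) : path_alg k Q := pbasis k (emb p).

Lemma pembM p q : pemb p * pemb q = lext pemb (pprod k p q).
Proof.
rewrite path_algM_basis /pprod pcomp_emb.
by case: (pcomp p q) => [r|] /=; rewrite ?lext_basis ?lext0.
Qed.

Lemma pemb_homog p : pa_homog (plen p) (pemb p).
Proof.
have -> : plen p = plen (emb p) by rewrite /plen /parrs /= size_map.
exact: pa_homog_basis.
Qed.

Definition emb_hom : graded_hom k P Q := lext_hom pembM pemb_homog.

(** On basis elements, the map that kills the paths leaving [P]; the preimage chosen by [cid] is
    unique by [emb_inj]. *)
Definition pret (q : qpath Q) : path_alg k P :=
  if pselect (exists p, emb p = q) is left e then pbasis k (projT1 (cid e)) else 0.

Lemma pret_emb p : pret (emb p) = pbasis k p.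
Proof.
rewrite /pret; case: pselect => [e|[]]; last by exists p.
by case: cid => q /= /emb_inj ->.
Qed.

Lemma pret_notin q : ~ (exists p, emb p = q) -> pret q = 0.
Proof. by rewrite /pret; case: pselect. Qed.

Lemma pretM p q : pret p * pret q = lext pret (pprod k p q).
Proof.
have [[p' <-]|np] := pselect (exists p', emb p' = p); last first.
  rewrite (pret_notin np) mul0r /pprod; case E: pcomp => [r|]; last by rewrite lext0.
  rewrite lext_basis pret_notin // => -[r' rE]; rewrite -rE in E.
  by have [p' [_ [pE _]]] := emb_pcomp E; apply: np; exists p'.
have [[q' <-]|nq] := pselect (exists q', emb q' = q); last first.
  rewrite (pret_notin nq) mulr0 /pprod; case E: pcomp => [r|]; last by rewrite lext0.
  rewrite lext_basis pret_notin // => -[r' rE]; rewrite -rE in E.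
  by have [_ [q' [_ qE]]] := emb_pcomp E; apply: nq; exists q'.
rewrite !pret_emb path_algM_basis /pprod pcomp_emb.
by case: pcomp => [r|] /=; rewrite ?lext0 // lext_basis pret_emb.
Qed.

Lemma pret_homog q : pa_homog (plen q) (pret q).
Proof.
have [[p <-]|nq] := pselect (exists p, emb p = q); last first.
  by rewrite (pret_notin nq); exact: pa_homog0.
have -> : plen (emb p) = plen p by rewrite /plen /parrs /= size_map.
rewrite pret_emb; exact: pa_homog_basis.
Qed.

Definition ret_hom : graded_hom k Q P := lext_hom pretM pret_homog.

Lemma ret_homK a : ret_hom (emb_hom a) = a.
Proof.
move: a; apply: klinear_eq => [||p]; last by rewrite /= !(lext_basis, pret_emb).
  exact: klinear_comp (klinear_lext _) (klinear_lext _).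
exact: klinear_id.
Qed.

Lemma emb_hom1 : emb_hom 1 = \sum_v pbasis k (ptriv (f v)).
Proof.
rewrite /= lext_sum; apply: eq_bigr => v _; rewrite lext_basis.
by congr pbasis; apply: val_inj.
Qed.

Lemma mul_emb_hom1 q :
  pbasis k q * emb_hom 1 = if psrc q \in codom f then pbasis k q else 0.
Proof.
rewrite emb_hom1 mulr_sumr; case: ifPn => [/codomP[v qv]|nq].
  rewrite (bigD1 v) //= path_algM_basis /pprod pcomp_trivr qv eqxx big1 ?addr0 //.
  move=> w wv; rewrite path_algM_basis /pprod pcomp_trivr qv inj_eq //.
  by rewrite eq_sym (negbTE wv).
rewrite big1 // => v _; rewrite path_algM_basis /pprod pcomp_trivr.
by case: eqP => // qv; rewrite qv codom_f in nq.
Qed.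

Lemma emb_hom1_mul q :
  emb_hom 1 * pbasis k q = if ptgt q \in codom f then pbasis k q else 0.
Proof.
rewrite emb_hom1 mulr_suml; case: ifPn => [/codomP[v qv]|nq].
  rewrite (bigD1 v) //= path_algM_basis /pprod pcomp_trivl qv eqxx big1 ?addr0 //.
  by move=> w /negbTE wv; rewrite path_algM_basis /pprod pcomp_trivl qv inj_eq // wv.
rewrite big1 // => v _; rewrite path_algM_basis /pprod pcomp_trivl.
by case: eqP => // qv; rewrite -qv codom_f in nq.
Qed.

Lemma emb_ret q :
  emb_hom (pret q) = if pselect (exists p, emb p = q) then pbasis k q else 0.
Proof.
case: pselect => [[p pq]|nq] /=; first by rewrite -pq pret_emb lext_basis.
by rewrite (pret_notin nq) /= lext0.
Qed.

(** Every arrow ends in [P]. Hence a path that starts in [P] stays there, which gives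
    [phi (psi b) = b * phi 1], and every nontrivial path ends in [P], which gives [phi 1 * b = b] in
    positive degrees. *)
Lemma QGr_source :
  (forall a : arr Q, exists w, atgt a = f w) ->
  equivalent_categories (QGr k Q) (QGr k P).
Proof.
move=> im_tgt; apply: (QGr_equivalent ret_homK); left; split=> [b|].
  move: b; apply: klinear_eq => [||q].
  - exact: klinear_comp (klinear_lext _) (klinear_lext _).
  - exact: klinear_mulr (klinear_id k Q).
  rewrite mul_emb_hom1 [ret_hom _]lext_basis emb_ret; case: pselect => [[p pq]|nq] /=.
    by rewrite -pq psrc_emb codom_f.
  case: ifP => // /codomP[v qv]; case: nq.
  by apply: path_lift qv _ => a _; exact: im_tgt.
(* Degree 0 must be excluded: [phi 1] kills the trivial paths at vertices outside [P]. *)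
exists 1%N => m b m1; move: b; apply: klinear_eq_homog => [||q qm].
- exact: klinear_mull (klinear_id k Q).
- exact: klinear_id.
 rewrite emb_hom1_mul; case: ifPn => // /negP[].
rewrite /ptgt; case/lastP E: (parrs q) => [|s a].
  by rewrite -qm /plen E in m1.
by rewrite map_rcons last_rcons; have [w ->] := im_tgt a; exact: codom_f.
Qed.

(** The dual argument: every arrow starts in [P], so a path that ends in [P] lies entirely in it,
    and every nontrivial path starts in [P]. *)
Lemma QGr_sink :
  (forall a : arr Q, exists w, asrc a = f w) ->
  equivalent_categories (QGr k Q) (QGr k P).
Proof.
move=> im_src; apply: (QGr_equivalent ret_homK); right; split=> [b|].
  move: b; apply: klinear_eq => [||q].
  - exact: klinear_comp (klinear_lext _) (klinear_lext _).
  - exact: klinear_mull (klinear_id k Q).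
  rewrite emb_hom1_mul [ret_hom _]lext_basis emb_ret; case: pselect => [[p pq]|nq] /=.
    by rewrite -pq ptgt_emb codom_f.
  case: ifP => // /codomP[w qw]; case: nq.
  (* The target of each arrow but the last is the source of the next one, hence in [P]; the last
     target is the end of the path. *)
  have path_tgt s : forall v, is_path v s -> last v (map (@atgt Q) s) = f w ->
      forall a, a \in s -> exists u, atgt a = f u.
    elim: s => // b' s IHs v /= /andP[_ ps] sw a; rewrite inE.
    case/predU1P=> [->|]; last exact: IHs ps sw a.
    case: s ps sw {IHs} => [|d s] /=; first by exists w.
    by case/andP=> /eqP <- _ _; exact: im_src.
  (* A trivial path starts where it ends; any other starts at the source of its first arrow. *)
  have [v qv] : exists v, psrc q = f v.
    move: (pvalP q) qw; rewrite /ptgt /psrc /parrs.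
    case: (val q) => v [|a s] /=; first by exists w.
    by case/andP=> /eqP <- _ _; exact: im_src.
  by apply: path_lift qv _; exact: path_tgt (pvalP q) qw.
exists 1%N => m b m1; move: b; apply: klinear_eq_homog => [||q qm].
- exact: klinear_mulr (klinear_id k Q).
- exact: klinear_id.
 rewrite mul_emb_hom1; case: ifPn => // /negP[].
move: (pvalP q) m1; rewrite -qm /plen /psrc /parrs.
case: (val q) => v [|a s] //= /andP[/eqP <- _] _.
by have [w ->] := im_src a; exact: codom_f.
Qed.

End FullEmbedding.

(** * Isomorphic quivers, removal of vertices, and the theorem *)

(** An isomorphism is a full embedding that reaches every vertex, so [QGr_source] covers it. *)
Lemma QGr_quiver_iso (k : fieldType) (Q R : quiver) :
  quiver_iso Q R -> equivalent_categories (QGr k Q) (QGr k R).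
Proof.
move=> [f [g [[f' fK f'K] [g' gK g'K] gs gt]]]; apply: equivalent_sym.
apply: (@QGr_source k Q R f g) => //; try exact: can_inj.
  by move=> a v w _ _; exists (g' a).
by move=> a; exists (f' (atgt a)).
Qed.

Lemma QGr_remove_vertex (k : fieldType) (Q : quiver) (v : vert Q) :
  is_source v \/ is_sink v ->
  equivalent_categories (QGr k Q) (QGr k (remove_vertex v)).
Proof.
pose f (w : vert (remove_vertex v)) : vert Q := sval w.
pose g (a : arr (remove_vertex v)) : arr Q := sval a.
have full a u w : asrc a = f u -> atgt a = f w -> exists b, g b = a.
  move=> au aw; have av : keeps v a by rewrite /keeps au aw (svalP u) (svalP w).
  by exists (exist _ a av).
case=> vP.
  apply: (@QGr_source k (remove_vertex v) Q f g) => //; try exact: val_inj.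
  by move=> a; exists (exist _ (atgt a) (vP a)).
apply: (@QGr_sink k (remove_vertex v) Q f g) => //; try exact: val_inj.
by move=> a; exists (exist _ (asrc a) (vP a)).
Qed.

Lemma QGr_prunes_to (k : fieldType) (Q R : quiver) :
  prunes_to Q R -> equivalent_categories (QGr k Q) (QGr k R).
Proof.
elim=> {Q R} [Q|Q v R vP _ IH]; last exact: equivalent_trans (QGr_remove_vertex k vP) IH.
(* Reflexivity comes from the identity isomorphism of [Q]. *)
by apply: QGr_quiver_iso; exists id, id; split=> //; exists id.
Qed.

Theorem theorem1p7 (k : fieldType) (Q Q' : quiver) :
  same_after_pruning Q Q' -> equivalent_categories (QGr k Q) (QGr k Q').
Proof.
move=> [R [R' [QR QR' RR']]].
apply: equivalent_trans (QGr_prunes_to k QR) _.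
apply: equivalent_trans (QGr_quiver_iso k RR') _.
exact: equivalent_sym (QGr_prunes_to k QR').
Qed.
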